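(* Let $\Omega\subset\mathbb R^d$ be open, bounded, and uniformly locally quasiconvex. Then there exists a bounded linear operator $E: C^1(\bar\Omega)\to C^1_b(\mathbb R^d)$ such that $(Ef)|_{\bar\Omega}=f$ for all $f\in C^1(\bar\Omega)$ (in particular, $\nabla(Ef)=\nabla f$ on $\bar\Omega$).
   Context: $C^1_b(\mathbb R^d)$ is the space of $f\in C^1(\mathbb R^d)$ with $f$ and $\nabla f$ bounded, normed by $\sup\{|\partial^\alpha f(x)|: |\alpha|\le 1, x\in\mathbb R^d\}$. For bounded open $\Omega$, $C^1(\bar\Omega)$ is the space of $f\in C^1(\Omega)$ such that $f$ and all first partial derivatives are uniformly continuous on $\Omega$, normed by $\sup\{|\partial^\alpha f(x)|:|\alpha|\le1,x\in\Omega\}$; $f$ and $\nabla f$ are identified with their continuous extensions to $\bar\Omega$. A set $\Omega\subset\mathbb R^d$ is uniformly locally quasiconvex if there are constants $r>0$, $L\ge1$ such that for all $x,y\in\Omega$ with $|x-y|\le r$ there is a Lipschitz curve $\gamma:[0,1]\to\Omega$ with $\gamma(0)=x$, $\gamma(1)=y$ and Lipschitz constant at most $L|y-x|$. *)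

(* Defs.v *)
From HB Require Import structures.
From mathcomp Require Import all_boot all_order all_algebra.
From mathcomp Require Import all_classical all_reals all_analysis.
Set Implicit Arguments. Unset Strict Implicit. Unset Printing Implicit Defensive.
Import Order.TTheory GRing.Theory Num.Theory.
Import numFieldNormedType.Exports.
Local Open Scope classical_set_scope.
Local Open Scope ring_scope.

Section Defs.
Variables (R : realType) (d : nat).
Notation V := 'rV[R]_d.

Definition enorm (x : V) : R := Num.sqrt (\sum_(i < d) x ord0 i ^+ 2).

Definition ebasis (i : 'I_d) : V := delta_mx 0 i.

Definition partial (f : V -> R) (i : 'I_d) (x : V) : R := 'D_(ebasis i) f x.

Definition unif_cont_on (A : set V) (g : V -> R) : Prop :=
  forall eps : R, 0 < eps -> exists2 delta : R, 0 < delta &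
    forall x y, A x -> A y -> enorm (x - y) < delta -> `|g x - g y| < eps.

Definition C1_closure (Om : set V) (f : V -> R) : Prop :=
  (forall x, Om x -> differentiable f x) /\
  unif_cont_on Om f /\ (forall i, unif_cont_on Om (partial f i)).

Definition C1_bounded_by (Om : set V) (f : V -> R) (M : R) : Prop :=
  forall x, Om x -> `|f x| <= M /\ (forall i, `|partial f i x| <= M).

Definition C1b (g : V -> R) : Prop :=
  (forall x, differentiable g x) /\ (forall i, continuous (partial g i)) /\
  exists M : R, C1_bounded_by setT g M.

Definition unif_loc_quasiconvex (Om : set V) : Prop :=
  exists r : R, exists L : R, 0 < r /\ 1 <= L /\
    forall x y, Om x -> Om y -> enorm (x - y) <= r ->
      exists gam : R -> V,
        [/\ gam 0 = x, gam 1 = y,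
            (forall t, 0 <= t <= 1 -> Om (gam t)) &
            forall s t, 0 <= s <= 1 -> 0 <= t <= 1 ->
              enorm (gam s - gam t) <= L * enorm (y - x) * `|s - t| ].
End Defs.

(* Main.v *)
Require Import Defs.
From HB Require Import structures.
From mathcomp Require Import all_boot all_order all_algebra.
From mathcomp Require Import all_classical all_reals all_analysis.
From mathcomp Require Import ring lra.
Import Order.TTheory GRing.Theory Num.Theory.
Import numFieldNormedType.Exports.
Local Open Scope classical_set_scope.
Local Open Scope ring_scope.

(** Whitney's extension theorem for C^1 functions, with gluing over scales in place
    of Whitney cubes.  At each scale [h n = h 0 / 8 ^ n] a spline partition of unity
    with finitely many cells, attached to points of [Om] that are [3 * h n]-close,
    averages the Taylor polynomials of [f]; its total mass is [1] on the
    [h n]-neighbourhood of [Om] and [0] farther than [3 * h n].  Gluing each scale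
    over the coarser ones gives, off the closure of [Om], a locally finite
    procedure in which only two consecutive scales, comparable to the distance to
    [Om], contribute.  On the closure the extension is the continuous extension
    of [f].

    Integrating along the Lipschitz curves of quasiconvexity, Taylor polynomials at
    points [p, b] of [Om] differ at [x] by at most a constant times the oscillation
    of the gradient times [|p - b| + |x - p|].  As the gradients of the weights are
    [O(1 / h n)], the extension and its gradient stay within the oscillation of the
    gradient of [f] from the Taylor polynomial at a nearby point of [Om].  With the
    trivial oscillation bound [2 * M] this is the norm estimate; with the uniform
    continuity of the gradient it is differentiability at the closure and
    continuity of the partial derivatives. *)

(** * Norms on row vectors and C^1 calculus *)

Section MaxNorm.
Context {R : realType} {d : nat}.
Implicit Types x y : 'rV[R]_d.

Lemma coord_le_norm x i : `|x ord0 i| <= `|x|.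
Proof.
by rewrite [leRHS]/Num.Def.normr /= mx_normrE; apply: (le_bigmax _ _ (ord0, i)).
Qed.

Lemma norm_le_coord x (c : R) :
  0 <= c -> (forall i, `|x ord0 i| <= c) -> `|x| <= c.
Proof.
move=> c0 xc; rewrite /Num.Def.normr /= mx_normrE; apply/bigmax_leP; split=> //.
by move=> [i j] _ /=; rewrite ord1.
Qed.

(** With [enorm_le_norm], this lets all later arguments use the max norm of row vectors; the
    Euclidean norm enters only through the hypotheses on [Om] and [f]. *)
Lemma norm_le_enorm x : `|x| <= enorm x.
Proof.
apply: norm_le_coord => [|i]; first exact: sqrtr_ge0.
rewrite -sqrtr_sqr ler_sqrt; last by apply: sumr_ge0 => j _; exact: sqr_ge0.
by rewrite (bigD1 i) //= lerDl; apply: sumr_ge0 => j _; exact: sqr_ge0.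
Qed.

Lemma enorm_le_norm x : enorm x <= d%:R * `|x|.
Proof.
rewrite -[leRHS]ger0_norm ?mulr_ge0 // -sqrtr_sqr ler_sqrt ?sqr_ge0 //.
apply: (@le_trans _ _ (\sum_(i < d) `|x| ^+ 2)).
  apply: ler_sum => i _; rewrite -real_normK ?num_real // ler_sqr ?nnegrE //.
  exact: coord_le_norm.
rewrite sumr_const card_ord -[leLHS]mulr_natl exprMn; apply: ler_wpM2r; first exact: sqr_ge0.
by rewrite -natrX ler_nat; case: (d) => // n; rewrite -mulnn leq_pmulr.
Qed.

Lemma sum_coord_le (a : 'I_d -> R) x (c : R) :
  (forall i, `|a i| <= c) -> `|\sum_i a i * x ord0 i| <= d%:R * c * `|x|.
Proof.
move=> ac; apply: (le_trans (ler_norm_sum _ _ _)).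
apply: (@le_trans _ _ (\sum_(i < d) c * `|x|)).
  by apply: ler_sum => i _; rewrite normrM ler_pM // coord_le_norm.
by rewrite sumr_const card_ord -[leLHS]mulr_natl mulrA.
Qed.

End MaxNorm.

Section Calculus.
Context {R : realType} {d : nat}.
Notation V := 'rV[R]_d.
Implicit Types (f g : V -> R) (x y : V).

Lemma nearP (P : V -> Prop) x :
  (\forall y \near x, P y) <->
  exists2 e : R, 0 < e & forall y, `|y - x| < e -> P y.
Proof.
split=> [/nbhs_ballP [e e0 eP]|[e e0 eP]].
  by exists e => // y yx; apply: eP; rewrite -ball_normE /= distrC.
by apply/nbhs_ballP; exists e => // y; rewrite -ball_normE /= distrC; exact: eP.
Qed.

Lemma continuous_atP f x : {for x, continuous f} <->
  forall e : R, 0 < e -> \forall y \near x, `|f y - f x| < e.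
Proof.
have FF := @nbhs_filter V x.
split=> [fx e e0|fx].
  move/(@cvgrPdist_lt R R V (nbhs x) FF f (f x)): fx => /(_ e e0).
  by apply: filterS => y; rewrite distrC.
apply/(@cvgrPdist_lt R R V (nbhs x) FF f (f x)) => e e0.
by have := fx e e0; apply: filterS => y; rewrite distrC.
Qed.

Lemma partial_diff f i x : differentiable f x ->
  partial f i x = 'd f x (ebasis R i).
Proof. exact: deriveE. Qed.

Lemma diffE_partial f x y : differentiable f x ->
  'd f x y = \sum_i partial f i x * y ord0 i.
Proof.
move=> fx; rewrite {1}(row_sum_delta y) linear_sum.
by apply: eq_bigr => i _; rewrite linearZ /= (partial_diff _ i _ fx) mulrC.
Qed.

Lemma differentiable_expand f x : differentiable f x ->
  forall e : R, 0 < e -> \forall y \near x,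
    `|f y - f x - \sum_i partial f i x * (y - x) ord0 i| <= e * `|y - x|.
Proof.
move=> fx e e0; have /diff_locally := (fx).
move/eqaddoP => /(_ e e0) /nbhs_ballP[r r0 H].
apply/nearP; exists r => // y yx.
have := H (y - x); rewrite -ball_normE /= sub0r normrN => /(_ yx).
by rewrite !fctE subrK -(diffE_partial f x (y - x) fx) opprD addrA.
Qed.

(** Converse of [differentiable_expand]: the linear form with coefficients [a] is continuous, so
    uniqueness of the differential identifies it. It gives differentiability at closure points,
    where only an estimate is at hand. *)
Lemma expand_differentiable f x (a : 'I_d -> R) :
  (forall e : R, 0 < e -> \forall y \near x,
    `|f y - f x - \sum_i a i * (y - x) ord0 i| <= e * `|y - x|) ->
  differentiable f x /\ forall i, partial f i x = a i.
Proof.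
move=> H.
pose A : 'cV[R]_d := \col_i a i.
pose l (v : V) : R := (v *m A) ord0 ord0.
have lin_l : linear l.
  by move=> k u v; rewrite /l mulmxDl -scalemxAl !mxE.
pose lM := GRing.isLinear.Build _ _ _ _ l lin_l.
pose L : {linear V -> R} := HB.pack l lM.
have lE v : L v = \sum_i a i * v ord0 i.
  by rewrite /= /l mxE; apply: eq_bigr => i _; rewrite mxE mulrC.
have Lc : continuous L.
  move=> v; apply/(continuous_atP (L : V -> R)) => e e0.
  pose c : R := 1 + \sum_i `|a i|.
  have c0 : 0 < c by apply: ltr_pwDl => //; apply: sumr_ge0.
  have ac i : `|a i| <= c.
    by rewrite /c (bigD1 i) //= addrCA lerDl; apply: addr_ge0 => //; apply: sumr_ge0.
  have K0 : 0 < d%:R * c + 1 by rewrite ltr_wpDl // mulr_ge0 // ltW.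
  apply/nearP; exists (e / (d%:R * c + 1)); first exact: divr_gt0.
  move=> y; rewrite ltr_pdivlMr // => yv; rewrite -linearB lE.
  apply: le_lt_trans (sum_coord_le _ _ _ ac) _.
  apply: le_lt_trans yv; by rewrite mulrC ler_wpM2l // lerDl ler01.
have E (e : R) : 0 < e -> \forall y \near (0 : V),
    `|f (y + x) - (f x + L y)| <= e * `|y|.
  move=> e0; apply/nbhs_ballP.
  have /nearP[r r0 {}H] := H e e0.
  exists r => // y; rewrite -ball_normE /= sub0r normrN => yr.
  have := H (y + x); rewrite addrK => /(_ yr).
  by rewrite -lE opprD addrA.
have dE : 'd f x = L :> (V -> R).
  by apply: diff_unique => //; apply/eqaddoP; exact: E.
have fx : differentiable f x.
  by apply/diff_locallyP; rewrite dE; split=> //; apply/eqaddoP; exact: E.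
split=> // i; rewrite partial_diff // dE lE (bigD1 i) //= big1.
  by rewrite /ebasis mxE !eqxx mulr1 addr0.
by move=> j ji; rewrite /ebasis mxE eqxx (negbTE ji) mulr0.
Qed.

Lemma near_eq_differentiable f g x : (\forall y \near x, f y = g y) ->
  differentiable f x ->
  differentiable g x /\ forall i, partial g i x = partial f i x.
Proof.
move=> fg fx; apply: expand_differentiable => e e0.
have fgx : f x = g x by exact: nbhs_singleton fg.
have := differentiable_expand f x fx e e0.
by apply: filterS2 fg => y fgy; rewrite fgy fgx.
Qed.

Lemma partial_cst (c : R) i x : partial (cst c) i x = 0.
Proof. exact: derive_cst. Qed.

Lemma partialD f g i x : differentiable f x -> differentiable g x ->
  partial (f \+ g) i x = partial f i x + partial g i x.
Proof. by move=> fx gx; apply: deriveD; exact: diff_derivable. Qed.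

Lemma partialM f g i x : differentiable f x -> differentiable g x ->
  partial (f \* g) i x = f x * partial g i x + g x * partial f i x.
Proof. by move=> fx gx; apply: deriveM; exact: diff_derivable. Qed.

Definition C1 f := (forall x, differentiable f x) /\
  (forall i, continuous (partial f i)).

Lemma C1_cst (c : R) : C1 (cst c).
Proof.
split=> [x|i]; first exact: differentiable_cst.
rewrite (_ : partial (cst c) i = cst 0); first exact: cst_continuous.
by apply/funext => x; exact: partial_cst.
Qed.

Lemma C1D f g : C1 f -> C1 g -> C1 (f \+ g).
Proof.
move=> [df cf] [dg cg]; split=> [x|i]; first exact: differentiableD.
rewrite (_ : partial _ i = partial f i \+ partial g i); last first.
  by apply/funext => x; exact: partialD.
by move=> x; apply: continuousD; [exact: cf|exact: cg].
Qed.

Lemma C1M f g : C1 f -> C1 g -> C1 (f \* g).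
Proof.
move=> [df cf] [dg cg]; split=> [x|i]; first exact: differentiableM.
rewrite (_ : partial _ i = (f \* partial g i) \+ (g \* partial f i)); last first.
  by apply/funext => x; exact: partialM.
move=> x; apply: continuousD; apply: continuousM.
- exact: differentiable_continuous.
- exact: cg.
- exact: differentiable_continuous.
- exact: cf.
Qed.

Lemma C1_sum (I : Type) (r : seq I) (F : I -> V -> R) :
  (forall i, C1 (F i)) -> C1 (fun x => \sum_(i <- r) F i x).
Proof.
move=> CF; elim: r => [|a r IH].
  by under eq_fun do rewrite big_nil; exact: C1_cst.
by under eq_fun do rewrite big_cons; exact: C1D.
Qed.

Lemma C1_prod (I : Type) (r : seq I) (P : pred I) (F : I -> V -> R) :
  (forall i, C1 (F i)) -> C1 (fun x => \prod_(i <- r | P i) F i x).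
Proof.
move=> CF; elim: r => [|a r IH].
  by under eq_fun do rewrite big_nil; exact: C1_cst.
under eq_fun do rewrite big_cons.
by case: (P a) => //; exact: C1M.
Qed.

Lemma partial_sum (I : Type) (r : seq I) (F : I -> V -> R) i x :
  (forall j, differentiable (F j) x) ->
  partial (fun x => \sum_(j <- r) F j x) i x = \sum_(j <- r) partial (F j) i x.
Proof.
move=> dF; suff [] : differentiable (fun y => \sum_(j <- r) F j y) x /\
  partial (fun x => \sum_(j <- r) F j x) i x = \sum_(j <- r) partial (F j) i x by [].
elim: r => [|a r [IHd IH]].
  rewrite big_nil; under eq_fun do rewrite big_nil.
  by split; [exact: differentiable_cst|exact: partial_cst].
rewrite big_cons -IH; under eq_fun do rewrite big_cons.
by split; [exact: differentiableD|exact: partialD].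
Qed.

Lemma C1_comp_coord (b b' : R -> R) (k : 'I_d) :
  (forall t : R, is_derive t (1 : R) b (b' t)) -> continuous b' ->
  C1 (fun x => b (x ord0 k)) /\
  forall i x, partial (fun x => b (x ord0 k)) i x = (i == k)%:R * b' (x ord0 k).
Proof.
move=> bb' cb'.
have H x : differentiable (fun x => b (x ord0 k)) x /\
    forall i, partial (fun x => b (x ord0 k)) i x = (i == k)%:R * b' (x ord0 k).
  have dc := @differentiable_coord R _ _ x ord0 k.
  have db : differentiable b (x ord0 k) by apply/derivable1_diffP.
  have dbc : differentiable (b \o (fun x : V => x ord0 k)) x.
    exact: differentiable_comp.
  split=> // i.
  rewrite partial_diff // diff_comp //=.
  have -> : 'd (fun x0 : V => x0 ord0 k : R) x (ebasis R i) = (i == k)%:R :> R.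
    rewrite -deriveE // /derive.
    apply: cvg_lim => //; apply: cvg_near_cst.
    apply/nbhs_ballP; exists 1 => //= h _ h0.
    rewrite /ebasis !mxE eqxx /= addrK eq_sym.
    by rewrite [_ *: _]mulrA mulVf // mul1r.
  rewrite deriv1E; last by apply/derivable1_diffP.
  by rewrite derive1E derive_val.
split; last by move=> i x; have [_ ->] := H x.
split=> [x|i]; first by have [] := H x.
rewrite (_ : partial _ i = cst (i == k)%:R \* (b' \o (fun x => x ord0 k))).
  move=> x; apply: continuousM; first exact: cst_continuous.
  apply: (@continuous_comp _ _ _ (fun x : V => x ord0 k) b'); last exact: cb'.
  exact: coord_continuous.
by apply/funext => x; have [_ ->] := H x.
Qed.

Lemma partial_invariant f i x :
  (forall t : R, f (t *: ebasis R i + x) = f x) -> partial f i x = 0.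
Proof.
move=> H; rewrite /partial /derive; apply: cvg_lim => //.
under eq_fun do rewrite /= H subrr scaler0.
exact: cvg_cst.
Qed.

End Calculus.

(** * A C^1 spline partition of unity on the line *)

(** A quadratic remainder bound differentiates the piecewise quadratic spline without treating its
    knots separately. *)
Lemma is_derive_quadratic (R : realType) (f : R -> R) (t c K : R) : 0 <= K ->
  (forall s, `|f s - f t - c * (s - t)| <= K * (s - t) ^+ 2) ->
  is_derive t (1 : R) f c.
Proof.
move=> K0 H.
have L : h^-1 *: ((f \o shift t) (h *: (1 : R)) - f t) @[h --> 0^'] --> c.
  apply/cvgrPdist_lt => e e0; apply/nbhs_ballP.
  exists (e / (K + 1)); first by rewrite /= divr_gt0 // ltr_wpDl.
  move=> h; rewrite /ball /= sub0r normrN ltr_pdivlMr ?ltr_wpDl // => he h0.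
  have -> : h%:A = h by rewrite /GRing.scale /= mulr1.
  have := H (h + t); rewrite addrK => {}H.
  have hp : 0 < `|h| by rewrite normr_gt0.
  rewrite -(ltr_pM2l hp) -normrM mulrBr.
  have -> : h * (h^-1 *: (f (h + t) - f t)) = f (h + t) - f t.
    by rewrite /GRing.scale /= mulrA mulfV // mul1r.
  rewrite distrC [h * c]mulrC.
  apply: le_lt_trans H _.
  rewrite -real_normK ?num_real // expr2 mulrCA ltr_pM2l //.
  by apply: le_lt_trans he; rewrite mulrC ler_wpM2l // lerDl.
split; first by apply/cvg_ex; exists c.
exact: cvg_lim L.
Qed.

Section Spline.
Context {R : realType}.
Implicit Types t u : R.

(* The C^1 quadratic spline equal to [0] on negative numbers and to [1] after [1];
   its derivative [step_spline'] is a hat function supported in [[0, 1]]. *)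
Definition step_spline t : R :=
  2 * Num.max t 0 ^+ 2 - 4 * Num.max (t - 2^-1) 0 ^+ 2
    + 2 * Num.max (t - 1) 0 ^+ 2.

Definition step_spline' t : R :=
  4 * Num.max t 0 - 8 * Num.max (t - 2^-1) 0 + 4 * Num.max (t - 1) 0.

Lemma step_spline_le0 t : t <= 0 -> step_spline t = 0.
Proof.
by move=> t0; rewrite /step_spline !max_r ?expr0n /=; lra.
Qed.

Lemma step_spline_ge1 t : 1 <= t -> step_spline t = 1.
Proof. by move=> t1; rewrite /step_spline !max_l; [field|lra..]. Qed.

Lemma step_spline_itv t : 0 <= step_spline t <= 1.
Proof.
have [t0|t0] := leP t 0; first by rewrite step_spline_le0 // lexx ler01.
have [t1|t1] := leP 1 t; first by rewrite step_spline_ge1 // lexx ler01.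
rewrite /step_spline (max_l (ltW t0)) (@max_r _ _ (t - 1)); last by lra.
have [h|h] := leP (t - 2^-1) 0; apply/andP; split; nra.
Qed.

Lemma step_spline'_itv t : 0 <= step_spline' t <= 2.
Proof.
rewrite /step_spline'.
by have [?|?] := leP t 0; have [?|?] := leP (t - 2^-1) 0;
  have [?|?] := leP (t - 1) 0; apply/andP; split; lra.
Qed.

Lemma step_spline'_out t : (t <= 0) || (1 <= t) -> step_spline' t = 0.
Proof.
rewrite /step_spline' => /orP[] h.
  by rewrite !max_r; [ring|lra..].
by rewrite !max_l; [field|lra..].
Qed.

(** The squared positive part is convex with derivative [2 * Num.max t 0], which is 2-Lipschitz. *)
Lemma sqr_max0_expand t u :
  0 <= Num.max u 0 ^+ 2 - Num.max t 0 ^+ 2 - 2 * Num.max t 0 * (u - t)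
    <= (u - t) ^+ 2.
Proof.
have := (sqr_ge0 u, sqr_ge0 t, sqr_ge0 (u - t)); rewrite !expr2 => -[[u2 t2] ut2].
have [u0|u0] := leP u 0; have [t0|t0] := leP t 0; apply/andP; split; nra.
Qed.

Lemma step_spline_expand t u :
  `|step_spline u - step_spline t - step_spline' t * (u - t)| <= 8 * (u - t) ^+ 2.
Proof.
have := sqr_max0_expand t u.
have := sqr_max0_expand (t - 2^-1) (u - 2^-1).
have := sqr_max0_expand (t - 1) (u - 1).
rewrite /step_spline /step_spline'.
have -> : u - 2^-1 - (t - 2^-1) = u - t by ring.
have -> : u - 1 - (t - 1) = u - t by ring.
have q0 := sqr_ge0 (u - t).
move: (_ ^+ 2) q0 (Num.max t 0) (Num.max (t - 2^-1) 0) (Num.max (t - 1) 0).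
move=> q q0 a b c /andP[? ?] /andP[? ?] /andP[? ?].
rewrite ler_norml; apply/andP; split; nra.
Qed.

Lemma step_spline'_continuous : continuous step_spline'.
Proof.
have cm (a : R) : continuous (fun t : R => Num.max (t - a) 0).
  apply: (@max_fun_continuous _ _ _ (fun t : R => t - a) (cst 0)).
    by move=> t; apply: continuousB; [exact: cvg_id|exact: cst_continuous].
  exact: cst_continuous.
have cm0 : continuous (fun t : R => Num.max t 0).
  by rewrite (_ : (fun _ => _) = (fun t : R => Num.max (t - 0) 0)) //;
    apply/funext => t; rewrite subr0.
pose m (a t : R) := Num.max (t - a) 0.
have -> : step_spline' = (cst 4 \* (fun t : R => Num.max t 0)
    \- cst 8 \* m 2^-1) \+ cst 4 \* m 1 by [].
move=> t; apply: continuousD; first apply: continuousB.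
- by apply: continuousM; [exact: cst_continuous|exact: cm0].
- by apply: continuousM; [exact: cst_continuous|exact: cm].
- by apply: continuousM; [exact: cst_continuous|exact: cm].
Qed.

(** The integer translates of the hat have supports with disjoint interiors, so at most one term is
    nonzero. *)
Lemma sum_step_spline'_le n u : \sum_(k < n) step_spline' (u - k%:R) <= 2.
Proof.
have [/existsP[k uk]|] :=
    boolP [exists k : 'I_n, step_spline' (u - k%:R) != 0].
  rewrite (bigD1 k) //= big1 ?addr0; first by case/andP: (step_spline'_itv (u - k%:R)).
  move=> j jk; apply: step_spline'_out.
  have uk1 : ~~ ((u - k%:R <= 0) || (1 <= u - k%:R)).
    by apply: contra uk => /step_spline'_out ->.
  move: uk1; rewrite negb_or -!ltNge => /andP[k0 k1].
  have : (j < k)%N || (k < j)%N by rewrite -neq_ltn.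
  case/orP => jk'; apply/orP; [right|left].
    have : (j.+1%:R <= k%:R :> R) by rewrite ler_nat.
    rewrite -natr1; lra.
  have : (k.+1%:R <= j%:R :> R) by rewrite ler_nat.
  rewrite -natr1; lra.
rewrite negb_exists => /forallP H.
by rewrite big1 // => k _; apply/eqP/negbNE/H.
Qed.

(** A difference of two unit shifts of the spline, so that sums over integer translates telescope;
    it is supported in [-1, 1]. *)
Definition bump u : R := step_spline (u + 1) - step_spline u.
Definition bump' u : R := step_spline' (u + 1) - step_spline' u.

Lemma bump_ge0 u : 0 <= bump u.
Proof.
rewrite /bump; have [/andP[a0 a1] /andP[b0 b1]] :=
  (step_spline_itv u, step_spline_itv (u + 1)).
have [u0|u0] := leP u 0; first by rewrite (step_spline_le0 u) // subr0.
by rewrite step_spline_ge1 ?subr_ge0 //; lra.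
Qed.

Lemma bump_out u : 1 <= `|u| -> bump u = 0.
Proof.
rewrite /bump ler_normr => /orP[] h.
  by rewrite !step_spline_ge1 ?subrr //; lra.
by rewrite !step_spline_le0 ?subrr //; lra.
Qed.

Lemma sum_bump n u :
  \sum_(k < n) bump (u - k%:R) = step_spline (u + 1) - step_spline (u + 1 - n%:R).
Proof.
elim: n => [|n IH]; first by rewrite big_ord0 subr0 subrr.
rewrite big_ord_recr /= IH /bump -natr1.
rewrite (_ : u - n%:R + 1 = u + 1 - n%:R); last by ring.
by rewrite (_ : u + 1 - (n%:R + 1) = u - n%:R); ring.
Qed.

Lemma sum_bump_le1 n u : \sum_(k < n) bump (u - k%:R) <= 1.
Proof.
rewrite sum_bump; have [/andP[_ a] /andP[b _]] :=
  (step_spline_itv (u + 1), step_spline_itv (u + 1 - n%:R)); lra.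
Qed.

Lemma sum_bump_eq1 n u : 0 <= u <= n%:R - 1 -> \sum_(k < n) bump (u - k%:R) = 1.
Proof.
case/andP => u0 un.
by rewrite sum_bump step_spline_ge1 ?step_spline_le0 ?subr0 //; lra.
Qed.

Lemma sum_bump'_le n u : \sum_(k < n) `|bump' (u - k%:R)| <= 4.
Proof.
apply: (@le_trans _ _ (\sum_(k < n) (step_spline' (u + 1 - k%:R)
   + step_spline' (u - k%:R)))).
  apply: ler_sum => k _; rewrite /bump'.
  rewrite (_ : u - k%:R + 1 = u + 1 - k%:R); last by ring.
  apply: le_trans (ler_normB _ _) _.
  have [/andP[a _] /andP[b _]] :=
    (step_spline'_itv (u + 1 - k%:R), step_spline'_itv (u - k%:R)).
  by rewrite !ger0_norm.
rewrite big_split /=.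
by have := sum_step_spline'_le n (u + 1); have := sum_step_spline'_le n u; lra.
Qed.

Lemma is_derive_bump_affine (a c : R) (t : R) :
  is_derive t (1 : R) (fun t : R => bump (a * t + c)) (a * bump' (a * t + c)).
Proof.
(* Each of the two splines in [bump] contributes a remainder of at most [8 * (a * (s - t)) ^+ 2]. *)
apply: (@is_derive_quadratic _ _ _ _ (16 * a ^+ 2)).
  by rewrite mulr_ge0 // sqr_ge0.
move=> s; rewrite /bump /bump'.
have := step_spline_expand (a * t + c) (a * s + c).
have := step_spline_expand (a * t + c + 1) (a * s + c + 1).
rewrite (_ : a * s + c + 1 - (a * t + c + 1) = a * (s - t)); last by ring.
rewrite (_ : a * s + c - (a * t + c) = a * (s - t)); last by ring.
rewrite !exprMn !ler_norml => /andP[? ?] /andP[? ?].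
apply/andP; split; nra.
Qed.

Lemma bump'_affine_continuous (a c : R) :
  continuous (fun t : R => a * bump' (a * t + c)).
Proof.
have ca (b : R) : continuous (fun t : R => step_spline' (a * t + b)).
  move=> t; apply: (@continuous_comp _ _ _ ((cst a \* id) \+ cst b) step_spline').
    apply: continuousD; last exact: cst_continuous.
    by apply: continuousM; [exact: cst_continuous|exact: cvg_id].
  exact: step_spline'_continuous.
have -> : (fun t => a * bump' (a * t + c)) = cst a \*
    ((fun t => step_spline' (a * t + (c + 1))) \- (fun t => step_spline' (a * t + c))).
  by apply/funext => t; rewrite /bump' /= addrA.
move=> t; apply: continuousM; first exact: cst_continuous.
by apply: continuousB; exact: ca.
Qed.

End Spline.

(** * Partitions of unity attached to points of the domain *)

Section Cover.
Context {R : realType} {d : nat}.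
Notation V := 'rV[R]_d.

(** Only these properties of the partition of unity are used later. The gradient bound [4 / h] does
    not depend on the number of cells. *)
Record cover (Om : set V) (h : R) := Cover {
  cell : finType;
  weight : cell -> V -> R;
  node : cell -> V;
  weight_C1 : forall q, C1 (weight q);
  weight_ge0 : forall q x, 0 <= weight q x;
  sum_weight_le1 : forall x, \sum_q weight q x <= 1;
  sum_weight_eq1 : forall x y, Om y -> `|x - y| < h -> \sum_q weight q x = 1;
  sum_partial_weight_le : forall i x, \sum_q `|partial (weight q) i x| <= 4 / h;
  node_in : forall q, Om (node q);
  weight_supp : forall q x, 3 * h < `|x - node q| -> weight q x = 0 }.

Section Grid.
Variables (h : R) (n : nat).
Hypothesis h0 : 0 < h.

(** Centred at [h * (k - n)]: with [k] running over ['I_(n + n)], the shift by [n] places the grid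
    around the origin. *)
Definition hat (k : nat) (t : R) : R := bump (h^-1 * t + (n%:R - k%:R)).

Definition hat_prod (q : {ffun 'I_d -> 'I_(n + n)}) (x : V) : R :=
  \prod_i hat (q i) (x ord0 i).

Definition center (q : {ffun 'I_d -> 'I_(n + n)}) : V :=
  \row_i (h * ((q i)%:R - n%:R)).

Lemma hat_partial (k : nat) (j : 'I_d) :
  C1 (fun x : V => hat k (x ord0 j)) /\ forall i (x : V),
    partial (fun x : V => hat k (x ord0 j)) i x
    = (i == j)%:R * (h^-1 * bump' (h^-1 * x ord0 j + (n%:R - k%:R))).
Proof.
have [|? ?] := @C1_comp_coord R d (hat k)
  (fun t => h^-1 * bump' (h^-1 * t + (n%:R - k%:R))) j
  (fun t => is_derive_bump_affine _ _ t).
  exact: bump'_affine_continuous.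
by split.
Qed.

Lemma hat_prod_C1 q : C1 (hat_prod q).
Proof. by apply: C1_prod => i; case: (hat_partial (q i) i). Qed.

Lemma hat_prod_ge0 q x : 0 <= hat_prod q x.
Proof. by apply: prodr_ge0 => i _; exact: bump_ge0. Qed.

Lemma hat_prod_supp q x : hat_prod q x != 0 -> `|x - center q| <= h.
Proof.
move=> /prodf_neq0 H; apply: norm_le_coord; first exact: ltW.
move=> i; rewrite !mxE leNgt; apply/negP => hx.
have /negP[] := H i isT; apply/eqP/bump_out.
have -> : h^-1 * x ord0 i + (n%:R - (q i)%:R)
    = h^-1 * (x ord0 i - h * ((q i)%:R - n%:R)).
  by field; rewrite gt_eqF.
by rewrite normrM gtr0_norm ?invr_gt0 // ler_pdivlMl // mulr1 ltW.
Qed.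

(** By distributivity the sum over all cells is a product over the coordinates of one-dimensional
    sums. *)
Lemma sum_hat_prod_le1 x : \sum_q hat_prod q x <= 1.
Proof.
rewrite /hat_prod -(bigA_distr_bigA (fun i (k : 'I_(n + n)) => hat k (x ord0 i))) /=.
apply: prodr_ile1 => i _; apply/andP; split.
  by apply: sumr_ge0 => k _; exact: bump_ge0.
by rewrite /hat; under eq_bigr do rewrite addrA; exact: sum_bump_le1.
Qed.

Lemma sum_hat_prod_eq1 x : `|x| + h <= h * n%:R -> \sum_q hat_prod q x = 1.
Proof.
move=> xn.
rewrite /hat_prod -(bigA_distr_bigA (fun i (k : 'I_(n + n)) => hat k (x ord0 i))) /=.
apply: big1 => i _; rewrite /hat; under eq_bigr do rewrite addrA.
apply: sum_bump_eq1.
(* The [n + n] bumps sum to 1 at arguments between 0 and [2n - 1]; here the argument is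
   [h^-1 * x ord0 i + n]. *)
have : `|h^-1 * x ord0 i| <= n%:R - 1.
  rewrite normrM gtr0_norm ?invr_gt0 // ler_pdivrMl // mulrBr mulr1 lerBrDr.
  by apply: le_trans xn; rewrite lerD2r coord_le_norm.
by rewrite ler_norml natrD => /andP[? ?]; apply/andP; split; lra.
Qed.

Lemma partial_hat_prod q i x : partial (hat_prod q) i x =
  h^-1 * bump' (h^-1 * x ord0 i + (n%:R - (q i)%:R))
    * \prod_(j | j != i) hat (q j) (x ord0 j).
Proof.
pose f (x : V) := hat (q i) (x ord0 i).
pose g (x : V) := \prod_(j | j != i) hat (q j) (x ord0 j).
have -> : hat_prod q = f \* g.
  by apply/funext => y; rewrite /hat_prod (bigD1 i).
have [[df _] pf] := hat_partial (q i) i.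
have [dg _] : C1 g by apply: C1_prod => j; case: (hat_partial (q j) j).
rewrite partialM // pf eqxx mul1r (partial_invariant g) ?mulr0 ?add0r 1?mulrC //.
move=> t; apply: eq_bigr => j ji.
by rewrite /ebasis !mxE eqxx (negbTE ji) mulr0 add0r.
Qed.

(** Only the factor of index [i] is differentiated. After distributing, that coordinate contributes
    at most [4 / h] and each other one at most 1. *)
Lemma sum_partial_hat_prod_le i x : \sum_q `|partial (hat_prod q) i x| <= 4 / h.
Proof.
pose c (j : 'I_d) (k : 'I_(n + n)) := if j == i
  then h^-1 * `|bump' (h^-1 * x ord0 j + (n%:R - k%:R))| else hat k (x ord0 j).
rewrite (eq_bigr (fun q : {ffun _} => \prod_j c j (q j))); last first.
  move=> q _; rewrite partial_hat_prod // [RHS](bigD1 i) //= {1}/c eqxx !normrM.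
  rewrite (ger0_norm (_ : 0 <= h^-1)) ?invr_ge0 ?ltW //; congr (_ * _).
  rewrite ger0_norm; last by apply: prodr_ge0 => j _; exact: bump_ge0.
  by apply: eq_bigr => j /negbTE ji; rewrite /c ji.
rewrite -(bigA_distr_bigA c) (bigD1 i) //= -[leRHS]mulr1.
have c0 j k : 0 <= c j k.
  rewrite /c; case: ifP => _; last exact: bump_ge0.
  by rewrite mulr_ge0 // invr_ge0 ltW.
apply: ler_pM.
- by apply: sumr_ge0.
- by apply: prodr_ge0 => j _; apply: sumr_ge0.
- under eq_bigr do rewrite /c eqxx addrA.
  by rewrite -mulr_sumr mulrC ler_pM2r ?invr_gt0 // sum_bump'_le.
- apply: prodr_ile1 => j /negbTE ji; rewrite sumr_ge0 //=.
  by under eq_bigr do rewrite /c ji /hat addrA; exact: sum_bump_le1.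
Qed.

End Grid.

(* Grid cells that do not come within [2 * h] of [Om] get weight [0]; the others
   are attached to a point of [Om] at distance at most [2 * h]. *)
Lemma cover_exists (Om : set V) (h : R) : 0 < h -> bounded_set Om -> Om !=set0 ->
  exists _ : cover Om h, True.
Proof.
move=> h0 bOm [y0 Oy0].
have [M M0 OM] : exists2 M : R, 0 <= M & forall y, Om y -> `|y| <= M.
  case: bOm => M [_ bM]; exists (`|M| + 1); first by rewrite addr_ge0.
  by move=> y Oy; apply: bM => //; rewrite (le_lt_trans (ler_norm M)) // ltrDl.
(* One [h] reaches the [h]-neighbourhood of [Om], the other is the margin required by
   [sum_hat_prod_eq1]. *)
have [n Mn] : exists n : nat, M + h + h <= h * n%:R.
  exists (Num.truncn (h^-1 * (M + h + h))).+1.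
  rewrite -ler_pdivrMl // ltW //; exact: truncnS_gt.
pose near_Om (q : {ffun 'I_d -> 'I_(n + n)}) :=
  [set p | Om p /\ `|p - center h n q| <= 2 * h].
pose G q := `[< exists p, near_Om q p >].
(* Discarded cells get the default node [y0], which still lies in [Om]. *)
pose p q := xget y0 (near_Om q).
have pO q : Om (p q) by rewrite /p; case: xgetP => // z _ [].
have pG q : G q -> `|p q - center h n q| <= 2 * h.
  by move=> /asboolP[z qz]; rewrite /p; case: xgetP => [? _ []//|/(_ z)].
pose w q x := if G q then hat_prod h n q x else 0.
have w0 q x : 0 <= w q x by rewrite /w; case: ifP => // _; exact: hat_prod_ge0.
have wle q x : w q x <= hat_prod h n q x.
  by rewrite /w; case: ifP => // _; exact: hat_prod_ge0.
have wC1 q : C1 (w q).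
  by rewrite /w; case: (G q); [exact: hat_prod_C1|exact: C1_cst].
have w_eq1 x y : Om y -> `|x - y| < h -> \sum_q w q x = 1.
  move=> Oy xy.
  (* No discarded cell is active at [x]: the centre of an active cell is within [h] of [x], hence
     within [2 * h] of [y]. *)
  rewrite -(sum_hat_prod_eq1 h n h0 x).
    apply: eq_bigr => q _; rewrite /w; case: ifPn => // /asboolP Gq.
    apply/esym/eqP; apply: contra_notT Gq => /hat_prod_supp - /(_ h0) xq.
    exists y; split=> //.
    have -> : y - center h n q = (y - x) + (x - center h n q).
      by rewrite addrA subrK.
    apply: le_trans (ler_normD _ _) _; rewrite distrC; lra.
  apply: le_trans Mn; rewrite lerD2r.
  have := OM y Oy; have := ler_normD (x - y) y; rewrite subrK; lra.
have w_part i x : \sum_q `|partial (w q) i x| <= 4 / h.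
  apply: le_trans (sum_partial_hat_prod_le h n h0 i x).
  apply: ler_sum => q _; rewrite /w; case: (G q) => //.
  by rewrite (_ : partial _ i x = 0) ?normr0 //; exact: partial_cst.
(* The radius is [h] from the point to the centre plus [2 * h] from the centre to the node. *)
have w_supp q x : 3 * h < `|x - p q| -> w q x = 0.
  move=> px; rewrite /w; case: ifP => // Gq.
  apply/eqP; apply: contraTT px => /hat_prod_supp - /(_ h0) xq.
  rewrite -leNgt; have := pG q Gq.
  have := ler_normD (x - center h n q) (center h n q - p q).
  rewrite addrA subrK (distrC (center h n q)); lra.
exists (@Cover Om h _ w p wC1 w0
  (fun x => le_trans (ler_sum _ (fun q _ => wle q x)) (sum_hat_prod_le1 h n x))
  w_eq1 w_part pO w_supp); last by [].
Qed.

End Cover.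

Arguments cell {R d Om h}.
Arguments weight {R d Om h}.
Arguments node {R d Om h}.
Arguments weight_C1 {R d Om h}.
Arguments weight_ge0 {R d Om h}.
Arguments sum_weight_le1 {R d Om h}.
Arguments sum_weight_eq1 {R d Om h}.
Arguments sum_partial_weight_le {R d Om h}.
Arguments node_in {R d Om h}.
Arguments weight_supp {R d Om h}.

(** * Taylor polynomials and quasiconvexity *)

(** Replaces the mean value inequality along curves that are merely Lipschitz. The supremum of the
    times up to which the bound holds is attained, and the local estimate there pushes past it
    unless it is 1. *)
Lemma unit_interval_lipschitz (R : realType) (phi : R -> R) (K : R) : 0 <= K ->
  (forall t, 0 <= t <= 1 -> exists2 e : R, 0 < e & forall s, 0 <= s <= 1 ->
    `|s - t| < e -> `|phi s - phi t| <= K * `|s - t|) ->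
  `|phi 1 - phi 0| <= K.
Proof.
move=> K0 H.
pose S := [set t : R | 0 <= t <= 1 /\ `|phi t - phi 0| <= K * t].
have S0 : S 0 by split; rewrite ?lexx ?ler01 // subrr normr0 mulr0.
have ubS : ubound S 1 by move=> t [/andP[]].
have hS : has_sup S by split; [exists 0|exists 1].
have c01 : 0 <= sup S <= 1.
  by apply/andP; split; [apply: ub_le_sup => //; case: hS|apply: ge_sup; case: hS].
have [e e0 He] := H _ c01.
have step t s : S t -> 0 <= s <= 1 -> t <= s ->
    `|phi s - phi t| <= K * (s - t) -> S s.
  move=> [_ St] s01 ts st; split=> //.
  have := ler_normD (phi s - phi t) (phi t - phi 0); rewrite addrA subrK; lra.
have Sc : S (sup S).
  have [t St tc] := sup_adherent e0 hS.
  have tleS : t <= sup S by apply: ub_le_sup => //; case: hS.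
  apply: (step t) => //.
  have [t01 _] := St; have E : `|t - sup S| = sup S - t.
    by rewrite distrC ger0_norm ?subr_ge0.
  by have := He t t01; rewrite E (distrC (phi t)); apply; lra.
have [c1|c1] := ltP (sup S) 1; last first.
  have c1E : sup S = 1 by apply/eqP; rewrite eq_le c1 andbT; case/andP: c01.
  by move: Sc => [_]; rewrite c1E mulr1.
have [c0 _] := andP c01.
pose s := Num.min 1 (sup S + e / 2).
have cs : sup S < s by rewrite lt_min c1 /= ltrDl divr_gt0.
have s1 : s <= 1 by rewrite ge_min lexx.
have se : s <= sup S + e / 2 by rewrite ge_min lexx orbT.
have s01 : 0 <= s <= 1 by apply/andP; split=> //; lra.
have Ss : S s.
  apply: (step (sup S)) => //; first exact: ltW.
  have E : `|s - sup S| = s - sup S by rewrite ger0_norm ?subr_ge0 ?(ltW cs).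
  by have := He s s01; rewrite E; apply; lra.
have : s <= sup S by apply: ub_le_sup => //; case: hS.
by rewrite leNgt cs.
Qed.

Section Taylor.
Context {R : realType} {d : nat}.
Notation V := 'rV[R]_d.
Implicit Types (f g : V -> R) (x y p b : V).

Definition taylor f p x : R := f p + \sum_i partial f i p * (x - p) ord0 i.

Lemma taylorxx f p : taylor f p p = f p.
Proof.
by rewrite /taylor subrr big1 ?addr0 // => i _; rewrite mxE mulr0.
Qed.

Lemma taylorB f p x y :
  taylor f p y - taylor f p x = \sum_i partial f i p * (y - x) ord0 i.
Proof.
rewrite /taylor opprD addrACA subrr add0r -sumrB; apply: eq_bigr => i _.
by rewrite !mxE; ring.
Qed.

Lemma taylor_differentiable f p x : differentiable (taylor f p) x /\
  forall i, partial (taylor f p) i x = partial f i p.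
Proof.
apply: expand_differentiable => e e0; apply/nearP; exists 1 => // y _.
by rewrite taylorB subrr normr0 mulr_ge0 // ltW.
Qed.

Lemma taylor_C1 f p : C1 (taylor f p).
Proof.
split=> [x|i]; first by case: (taylor_differentiable f p x).
rewrite (_ : partial _ i = cst (partial f i p)); first exact: cst_continuous.
by apply/funext => x; case: (taylor_differentiable f p x).
Qed.

Lemma partialDl (a : R) f g i x : differentiable f x -> differentiable g x ->
  partial (fun x => a * f x + g x) i x = a * partial f i x + partial g i x.
Proof.
move=> fx gx; have fa : differentiable (cst a \* f) x.
  by apply: differentiableM.
by rewrite (partialD (cst a \* f) g) // partialM // partial_cst mulr0 addr0.
Qed.

Lemma taylorDl (a : R) f g p x : differentiable f p -> differentiable g p ->
  taylor (fun x => a * f x + g x) p x = a * taylor f p x + taylor g p x.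
Proof.
move=> fp gp; rewrite /taylor mulrDr addrACA mulr_sumr -big_split /=.
by congr (_ + _); apply: eq_bigr => i _; rewrite partialDl // mulrDl mulrA.
Qed.

Definition quasiconvex_max (Om : set V) (r L : R) := forall x y, Om x -> Om y ->
  `|x - y| <= r -> exists gam : R -> V,
    [/\ gam 0 = x, gam 1 = y, (forall t, 0 <= t <= 1 -> Om (gam t)) &
        forall s t, 0 <= s <= 1 -> 0 <= t <= 1 ->
          `|gam s - gam t| <= L * `|y - x| * `|s - t|].

Lemma unif_loc_quasiconvex_max (Om : set V) : unif_loc_quasiconvex Om ->
  exists r L : R, [/\ 0 < r, 1 <= L & quasiconvex_max Om r L].
Proof.
move=> [r [L [r0 [L1 H]]]].
(* Using [d.+1] instead of [d] keeps the divisor positive in dimension 0. *)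
have D0 : 0 < d.+1%:R :> R by rewrite ltr0n.
have L0 : 0 <= L by apply: le_trans L1.
have dD (x : V) : enorm x <= d.+1%:R * `|x|.
  by apply: le_trans (enorm_le_norm x) _; rewrite ler_wpM2r // ler_nat.
exists (r / d.+1%:R), (L * d.+1%:R); split; first exact: divr_gt0.
  by rewrite -[leLHS]mulr1 ler_pM // ler1n.
move=> x y Ox Oy; rewrite ler_pdivlMr // mulrC => xy.
have [gam [g0 g1 gO gL]] := H x y Ox Oy (le_trans (dD _) xy).
exists gam; split=> // s t s01 t01.
apply: le_trans (norm_le_enorm _) _; apply: le_trans (gL s t s01 t01) _.
by rewrite -!mulrA mulrA [leRHS]mulrA [leRHS]mulrA ler_wpM2r // -mulrA ler_wpM2l.
Qed.

Section Remainder.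
Variables (Om : set V) (r L : R) (f : V -> R).
Hypotheses (L1 : 1 <= L) (qcOm : quasiconvex_max Om r L).
Hypothesis df : forall x, Om x -> differentiable f x.

Definition grad_osc (b : V) (rho eta : R) := forall z, Om z -> `|z - b| <= rho ->
  forall i, `|partial f i z - partial f i b| <= eta.

(** The curve from [b] to [p] stays within [L * |p - b|] of [b], so the gradient of [f - taylor f b]
    is at most [eta] in each coordinate along it. *)
Lemma taylor_remainder b p (eta : R) : Om b -> Om p -> `|p - b| <= r -> 0 <= eta ->
  grad_osc b (L * `|p - b|) eta ->
  `|f p - taylor f b p| <= d%:R * eta * (L * `|p - b|).
Proof.
move=> Ob Op pb eta0 osc.
have L0 : 0 <= L by apply: le_trans L1.
have bp : `|b - p| <= r by rewrite distrC.
have [gam [g0 g1 gO gL]] := qcOm _ _ Ob Op bp.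
pose phi t := f (gam t) - taylor f b (gam t).
have phi0 : phi 0 = 0 by rewrite /phi g0 taylorxx subrr.
have <- : phi 1 - phi 0 = f p - taylor f b p by rewrite phi0 subr0 /phi g1.
have Lpb0 : 0 <= L * `|p - b| by rewrite mulr_ge0.
apply/ler_addgt0Pr => e0 e00.
(* Slack for the first-order expansions of [f] on the curve; the [+ 1] covers the case [p = b]. *)
pose e := e0 / (L * `|p - b| + 1).
have e_gt0 : 0 < e by rewrite divr_gt0 // ltr_wpDl.
have eLe : e * (L * `|p - b|) <= e0.
  by rewrite /e mulrAC ler_pdivrMr ?ltr_wpDl // ler_wpM2l ?lerDl // ltW.
apply: (@le_trans _ _ ((d%:R * eta + e) * (L * `|p - b|))); last first.
  by rewrite mulrDl lerD2l.
have K0 : 0 <= d%:R * eta + e by apply: addr_ge0; [exact: mulr_ge0|exact: ltW].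
apply: (@unit_interval_lipschitz _ phi) => [|t t01].
  exact: mulr_ge0.
have Ot := gO t t01.
have /nearP[rho rho0 Hrho] := differentiable_expand f (gam t) (df _ Ot) e e_gt0.
exists (rho / (L * `|p - b| + 1)); first by rewrite divr_gt0 // ltr_wpDl.
move=> s s01; rewrite ltr_pdivlMr ?ltr_wpDl // => st.
have gst := gL s t s01 t01.
have gam_st : `|gam s - gam t| < rho.
  apply: le_lt_trans gst (le_lt_trans _ st).
  by rewrite mulrC ler_wpM2l // lerDl.
apply: (@le_trans _ _ ((d%:R * eta + e) * `|gam s - gam t|)); last first.
  by rewrite -mulrA ler_wpM2l.
have -> : phi s - phi t
  = (f (gam s) - f (gam t) - \sum_i partial f i (gam t) * (gam s - gam t) ord0 i)
  + \sum_i (partial f i (gam t) - partial f i b) * (gam s - gam t) ord0 i.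
  under [X in _ = _ + X]eq_bigr do rewrite mulrBl.
  rewrite sumrB addrA subrK -taylorB /phi; ring.
apply: le_trans (ler_normD _ _) _; rewrite mulrDl addrC lerD //; last exact: Hrho.
apply: sum_coord_le => i; apply: osc => //.
have z01 : 0 <= (0 : R) <= 1 by rewrite lexx ler01.
have := gL t 0 t01 z01; rewrite g0 subr0 => /le_trans; apply.
by case/andP: t01 => t0 t1; rewrite (ger0_norm t0) ler_piMr.
Qed.

(** The difference is affine in [x]: its value at [p] is the Taylor remainder and its slope is a
    difference of gradients. *)
Lemma taylor_diff b p x (eta : R) : Om b -> Om p -> `|p - b| <= r -> 0 <= eta ->
  grad_osc b (L * `|p - b|) eta ->
  `|taylor f p x - taylor f b x| <= d%:R * eta * L * (`|p - b| + `|x - p|).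
Proof.
move=> Ob Op pb eta0 osc.
have -> : taylor f p x - taylor f b x = (f p - taylor f b p)
    + \sum_i (partial f i p - partial f i b) * (x - p) ord0 i.
  under eq_bigr do rewrite mulrBl.
  by rewrite sumrB -(taylorB f b) /taylor; ring.
apply: le_trans (ler_normD _ _) _; rewrite mulrDr lerD //.
  by rewrite -[leRHS]mulrA; exact: taylor_remainder.
apply: le_trans (sum_coord_le _ _ eta _) _ => [i|].
  by apply: osc => //; rewrite ler_peMl.
by rewrite ler_wpM2r // ler_peMr // mulr_ge0.
Qed.

End Remainder.
End Taylor.

(** * Averages of Taylor polynomials *)

Section Patch.
Context {R : realType} {d : nat}.
Notation V := 'rV[R]_d.
Implicit Types (f l : V -> R) (x y p b : V).

Section OneScale.
Variables (Om : set V) (h : R) (c : cover Om h).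
Hypothesis h0 : 0 < h.

Definition mass x : R := \sum_q weight c q x.
Definition patch f x : R := \sum_q weight c q x * taylor f (node c q) x.

Lemma mass_C1 : C1 mass.
Proof. by apply: C1_sum => q; exact: weight_C1. Qed.

Lemma patch_C1 f : C1 (patch f).
Proof.
by apply: C1_sum => q; apply: C1M; [exact: weight_C1|exact: taylor_C1].
Qed.

Lemma mass_ge0 x : 0 <= mass x.
Proof. by apply: sumr_ge0 => q _; exact: weight_ge0. Qed.

Lemma mass_le1 x : mass x <= 1.
Proof. exact: sum_weight_le1. Qed.

Lemma partial_mass_le i x : `|partial mass i x| <= 4 / h.
Proof.
rewrite partial_sum => [|q]; last by case: (weight_C1 c q).
exact: le_trans (ler_norm_sum _ _ _) (sum_partial_weight_le c i x).
Qed.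

Lemma mass_eq1_near x y : Om y -> `|x - y| < h -> \forall z \near x, mass z = 1.
Proof.
move=> Oy xy; apply/nearP; exists (h - `|x - y|); first by rewrite subr_gt0.
move=> z zx; apply: (sum_weight_eq1 c z y Oy).
have -> : z - y = (z - x) + (x - y) by rewrite addrA subrK.
apply: le_lt_trans (ler_normD _ _) _; lra.
Qed.

Lemma partial_weight_supp q i x : 3 * h < `|x - node c q| ->
  partial (weight c q) i x = 0.
Proof.
move=> xq; have <- := partial_cst (0 : R) i x.
apply: near_eq_derive; apply/nearP; exists (`|x - node c q| - 3 * h).
  by rewrite subr_gt0.
move=> z zx; apply: weight_supp.
have := ler_normD (x - z) (z - node c q); rewrite addrA subrK (distrC x z); lra.
Qed.

Lemma patch_mass_far f x : (forall y, Om y -> 3 * h < `|x - y|) ->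
  patch f x = 0 /\ mass x = 0.
Proof.
move=> far; split; apply: big1 => q _; rewrite weight_supp ?mul0r //;
  by apply: far; exact: node_in.
Qed.

(** [patch f - mass * l] is the weighted sum of [taylor f (node c q) - l], in which only nodes
    within [3 * h] of [x] count. In the product rule, differentiating the weights costs [4 / h * A]
    and differentiating the polynomials costs [B]. *)
Lemma patch_deviation f l x (A B : R) : (forall y, differentiable l y) ->
  0 <= A -> 0 <= B ->
  (forall q, `|x - node c q| <= 3 * h ->
     `|taylor f (node c q) x - l x| <= A /\
     forall i, `|partial f i (node c q) - partial l i x| <= B) ->
  `|patch f x - mass x * l x| <= A /\
  forall i, `|partial (patch f) i x - partial (mass \* l) i x| <= 4 / h * A + B.
Proof.
move=> dl A0 B0 H.
have wA q : `|weight c q x * (taylor f (node c q) x - l x)| <= weight c q x * A.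
  have [far|close] := ltP (3 * h) `|x - node c q|.
    by rewrite weight_supp // !mul0r normr0.
  have [HA _] := H q close.
  by rewrite normrM ger0_norm ?weight_ge0 // ler_wpM2l // weight_ge0.
have wB q i : `|weight c q x * (partial f i (node c q) - partial l i x)|
    <= weight c q x * B.
  have [far|close] := ltP (3 * h) `|x - node c q|.
    by rewrite weight_supp // !mul0r normr0.
  have [_ HB] := H q close.
  by rewrite normrM ger0_norm ?weight_ge0 // ler_wpM2l // weight_ge0.
have dwA q i : `|partial (weight c q) i x * (taylor f (node c q) x - l x)|
    <= `|partial (weight c q) i x| * A.
  have [far|close] := ltP (3 * h) `|x - node c q|.
    by rewrite partial_weight_supp // normr0 !mul0r normr0.
  have [HA _] := H q close.
  by rewrite normrM ler_wpM2l.
split=> [|i].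
  rewrite /patch /mass mulr_suml -sumrB.
  under eq_bigr do rewrite -mulrBr.
  apply: le_trans (ler_norm_sum _ _ _) _.
  apply: le_trans (ler_sum _ (fun q _ => wA q)) _.
  by rewrite -mulr_suml ler_piMl // sum_weight_le1.
have dw q : differentiable (weight c q) x by case: (weight_C1 c q).
have dt q : differentiable (taylor f (node c q)) x.
  by case: (taylor_differentiable f (node c q) x).
rewrite (partialM mass l) //; last by case: mass_C1.
rewrite /mass (partial_sum _ _ (weight c)) // mulr_suml mulr_sumr -big_split /=.
rewrite (partial_sum _ _ (fun q => weight c q \* taylor f (node c q))); last first.
  by move=> q; apply: differentiableM.
rewrite -sumrB.
rewrite (eq_bigr (fun q => weight c q x * (partial f i (node c q) - partial l i x)
   + partial (weight c q) i x * (taylor f (node c q) x - l x))); last first.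
  move=> q _; rewrite partialM //.
  have [_ ->] := taylor_differentiable f (node c q) x; ring.
apply: le_trans (ler_norm_sum _ _ _) _.
apply: le_trans (ler_sum _ (fun q _ => le_trans (ler_normD _ _)
  (lerD (wB q i) (dwA q i)))) _.
rewrite big_split /= -!mulr_suml addrC lerD //.
  by rewrite ler_wpM2r // sum_partial_weight_le.
by rewrite ler_piMl // sum_weight_le1.
Qed.

Lemma patchDl (a : R) f g x :
  (forall y, Om y -> differentiable f y) -> (forall y, Om y -> differentiable g y) ->
  patch (fun x => a * f x + g x) x = a * patch f x + patch g x.
Proof.
move=> df dg; rewrite /patch mulr_sumr -big_split; apply: eq_bigr => q _ /=.
rewrite taylorDl; [ring|apply: df; exact: node_in|apply: dg; exact: node_in].
Qed.

End OneScale.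

Arguments mass {Om h}.
Arguments patch {Om h}.
Arguments mass_C1 {Om h}.
Arguments patch_C1 {Om h}.
Arguments mass_ge0 {Om h}.
Arguments mass_le1 {Om h}.
Arguments mass_eq1_near {Om h}.

(* Since [mass c = 1] near [x], [G - l] is near [x] the sum of
   [patch c' f - mass c' * l] and [(1 - mass c') * (patch c f - mass c * l)]. *)
Lemma two_scale_deviation (Om : set V) (h h' : R) (c : cover Om h) (c' : cover Om h')
    f l x y (A B : R) : 0 < h -> 0 < h' -> h' <= h -> Om y -> `|x - y| < h ->
  (forall z, differentiable l z) -> 0 <= A -> 0 <= B ->
  (forall p, Om p -> `|x - p| <= 3 * h -> `|taylor f p x - l x| <= A /\
     forall i, `|partial f i p - partial l i x| <= B) ->
  let G := patch c' f \+ (cst 1 \- mass c') \* patch c f in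
  `|G x - l x| <= 2 * A /\
  forall i, `|partial G i x - partial l i x| <= 12 / h' * A + 2 * B.
Proof.
move=> h0 h'0 hh' Oy xy dl A0 B0 H G.
have m1 := mass_eq1_near c x y Oy xy.
have m1x : mass c x = 1 := nbhs_singleton m1.
have [D1 D2] : `|patch c f x - mass c x * l x| <= A /\
  forall i, `|partial (patch c f) i x - partial (mass c \* l) i x| <= 4 / h * A + B.
  apply: patch_deviation => // q qx; apply: H => //; exact: node_in.
have [D1' D2'] : `|patch c' f x - mass c' x * l x| <= A /\
  forall i, `|partial (patch c' f) i x - partial (mass c' \* l) i x|
    <= 4 / h' * A + B.
  apply: patch_deviation => // q qx; apply: H; first exact: node_in.
  by apply: le_trans qx _; rewrite ler_wpM2l.
have m'0 := mass_ge0 c' x; have m'1 := mass_le1 c' x.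
rewrite m1x mul1r in D1.
have Gx : G x - l x = (patch c' f x - mass c' x * l x)
    + (1 - mass c' x) * (patch c f x - l x) by rewrite /G /=; ring.
have E : `|(1 - mass c' x) * (patch c f x - l x)| <= A.
  by rewrite normrM ger0_norm ?subr_ge0 // -[leRHS]mul1r ler_pM // ?subr_ge0 // gerBl.
split.
  rewrite Gx; apply: le_trans (ler_normD _ _) _; lra.
move=> i.
have dp := (patch_C1 c f).1 x; have dp' := (patch_C1 c' f).1 x.
have dm := (mass_C1 c).1 x; have dm' := (mass_C1 c').1 x.
have d1m' : differentiable (cst 1 \- mass c') x by exact: differentiableB.
have p1m' : partial (cst 1 \- mass c') i x = - partial (mass c') i x.
  rewrite /partial deriveB ?derive_cst ?sub0r //; exact: diff_derivable.
have -> : partial G i x = partial (patch c' f) i x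
    + ((1 - mass c' x) * partial (patch c f) i x
       - patch c f x * partial (mass c') i x).
  rewrite /G partialD //; last exact: differentiableM.
  by rewrite partialM // p1m' mulrN.
(* The mass is 1 on a whole neighbourhood of [x], so it also drops out of the derivative. *)
have pml : partial (mass c \* l) i x = partial l i x.
  apply: near_eq_derive; apply: filterS m1 => z /= ->; exact: mul1r.
have := D2 i; have := D2' i; rewrite pml partialM // => {}D2' {}D2.
have -> : partial (patch c' f) i x + ((1 - mass c' x) * partial (patch c f) i x
       - patch c f x * partial (mass c') i x) - partial l i x
  = (partial (patch c' f) i x
      - (mass c' x * partial l i x + l x * partial (mass c') i x))
    + ((1 - mass c' x) * (partial (patch c f) i x - partial l i x)
      - partial (mass c') i x * (patch c f x - l x)) by ring.
have E2 : `|(1 - mass c' x) * (partial (patch c f) i x - partial l i x)|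
    <= 4 / h * A + B.
  by rewrite normrM ger0_norm ?subr_ge0 // -[leRHS]mul1r ler_pM // ?subr_ge0 // gerBl.
have E3 : `|partial (mass c') i x * (patch c f x - l x)| <= 4 / h' * A.
  by rewrite normrM ler_pM // partial_mass_le.
(* This makes three terms [4 / h' * A]: from the two patches and from the derivative of
   [mass c']. *)
have hA : 4 / h * A <= 4 / h' * A.
  by rewrite ler_wpM2r // ler_wpM2l // lef_pV2.
apply: le_trans (ler_normD _ _) _.
have := ler_normB ((1 - mass c' x) * (partial (patch c f) i x - partial l i x))
  (partial (mass c') i x * (patch c f x - l x)).
have -> : 12 / h' * A = 3 * (4 / h' * A) by ring.
lra.
Qed.

End Patch.

Arguments mass {R d Om h}.
Arguments patch {R d Om h}.
Arguments mass_C1 {R d Om h}.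
Arguments patch_C1 {R d Om h}.
Arguments mass_ge0 {R d Om h}.
Arguments mass_le1 {R d Om h}.
Arguments mass_eq1_near {R d Om h}.

(** * The extension operator *)

Lemma cvg_sumr (R : realType) (T I : Type) (F : set_system T) {FF : Filter F}
    (r : seq I) (g : I -> T -> R) (l : I -> R) :
  (forall i, g i x @[x --> F] --> l i) ->
  (\sum_(i <- r) g i x) @[x --> F] --> \sum_(i <- r) l i.
Proof.
move=> gl; elim: r => [|i r IH].
  by rewrite big_nil; under eq_fun do rewrite big_nil; exact: cvg_cst.
by rewrite big_cons; under eq_fun do rewrite big_cons; exact: cvgD.
Qed.

(** * Continuous extensions to the closure of the domain *)

Section ClosureLimits.
Context {R : realType} {d : nat}.
Notation V := 'rV[R]_d.
Variable Om : set V.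
Implicit Types (f g : V -> R) (x y a b : V).

Lemma closure_normP x :
  closure Om x <-> forall e : R, 0 < e -> exists2 y, Om y & `|y - x| < e.
Proof.
split=> [cx e e0|H B /nearP[e e0 eB]].
  have [|y [Oy xy]] := cx [set y | `|y - x| < e]; last by exists y.
  by apply/nearP; exists e.
by have [y Oy yx] := H e e0; exists y; split=> //; exact: eB.
Qed.

Lemma within_nearP (P : V -> Prop) x : within Om (nbhs x) P <->
  exists2 e : R, 0 < e & forall y, Om y -> `|y - x| < e -> P y.
Proof.
split=> [/nearP[e e0 H]|[e e0 H]]; first by exists e => // y Oy /H; exact.
by apply/nearP; exists e => // y yx Oy; exact: H.
Qed.

Lemma unif_cont_on_norm g : unif_cont_on Om g -> forall e : R, 0 < e ->
  exists2 r : R, 0 < r & forall x y, Om x -> Om y -> `|x - y| < r ->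
    `|g x - g y| < e.
Proof.
move=> ug e e0; have [r r0 H] := ug e e0.
have D0 : 0 < d.+1%:R :> R by rewrite ltr0n.
exists (r / d.+1%:R) => [|x y Ox Oy]; first exact: divr_gt0.
rewrite ltr_pdivlMr // mulrC => xy; apply: H => //.
apply: le_lt_trans (enorm_le_norm _) (le_lt_trans _ xy).
by rewrite ler_wpM2r // ler_nat.
Qed.

Definition glim g x : R := lim (g @ within Om (nbhs x)).

(** Uniform continuity makes the image filter Cauchy, and [R] is complete. *)
Lemma glim_cvg g x : unif_cont_on Om g -> closure Om x ->
  g @ within Om (nbhs x) --> glim g x.
Proof.
move=> ug cx.
have FF : ProperFilter (within Om (nbhs x)) by exact: within_nbhs_proper.
rewrite /glim; apply/cauchy_cvgP/cauchy_exP => e e0.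
have [r r0 H] := unif_cont_on_norm g ug e e0.
have r20 : 0 < r / 2 by rewrite divr_gt0.
have [y Oy yx] := (closure_normP x).1 cx (r / 2) r20.
exists (g y); apply/within_nearP; exists (r / 2) => // z Oz zx.
rewrite -ball_normE /=; apply: H => //.
have := ler_distD x y z; rewrite (distrC x z); lra.
Qed.

Lemma cvg_glim g x (l : R) : closure Om x ->
  g @ within Om (nbhs x) --> l -> glim g x = l.
Proof.
move=> cx gl; have FF : ProperFilter (within Om (nbhs x)).
  exact: within_nbhs_proper.
exact: cvg_lim gl.
Qed.

Lemma glimP g x (e : R) : unif_cont_on Om g -> closure Om x -> 0 < e ->
  exists2 r : R, 0 < r & forall y, Om y -> `|y - x| < r -> `|g y - glim g x| < e.
Proof.
move=> ug cx e0.
have FF : ProperFilter (within Om (nbhs x)) by exact: within_nbhs_proper.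
have /cvgrPdist_lt /(_ e e0) /within_nearP[r r0 H] := glim_cvg g x ug cx.
by exists r => // y Oy yx; rewrite distrC; exact: H.
Qed.

Lemma glim_le g x (M : R) : unif_cont_on Om g -> closure Om x ->
  (forall y, Om y -> `|g y| <= M) -> `|glim g x| <= M.
Proof.
move=> ug cx gM; apply/ler_addgt0Pr => e e0.
have [r r0 H] := glimP g x e ug cx e0.
have [y Oy yx] := (closure_normP x).1 cx r r0.
have := H y Oy yx; have := gM y Oy; rewrite distrC.
by have := ler_normD (glim g x - g y) (g y); rewrite subrK; lra.
Qed.

Lemma glimDl (c : R) f g x : unif_cont_on Om f -> unif_cont_on Om g ->
  closure Om x -> glim (fun y => c * f y + g y) x = c * glim f x + glim g x.
Proof.
move=> uf ug cx; apply: cvg_glim => //.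
have FF : ProperFilter (within Om (nbhs x)) by exact: within_nbhs_proper.
by apply: cvgD; [apply: cvgM; [exact: cvg_cst|]|]; exact: glim_cvg.
Qed.

Definition taylor_bar f a x : R :=
  glim f a + \sum_i glim (partial f i) a * (x - a) ord0 i.

(** The radius depends on [x], which is harmless: in each use [b] is chosen after [x]. *)
Lemma taylor_cvg f a x (e : R) : C1_closure Om f -> closure Om a -> 0 < e ->
  exists2 r : R, 0 < r & forall b, Om b -> `|b - a| < r ->
    `|taylor f b x - taylor_bar f a x| < e.
Proof.
move=> [_ [uf up]] ca e0.
have FF : ProperFilter (within Om (nbhs a)) by exact: within_nbhs_proper.
have H : taylor f b x @[b --> within Om (nbhs a)] --> taylor_bar f a x.
  rewrite /taylor; apply: cvgD; first exact: glim_cvg.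
  apply: cvg_sumr => i; apply: cvgM; first exact: glim_cvg.
  apply: cvg_within_filter; under eq_fun do rewrite !mxE.
  rewrite !mxE; apply: cvgB; first exact: cvg_cst.
  exact: coord_continuous.
move/cvgrPdist_lt: H => /(_ e e0) /within_nearP[r r0 H].
by exists r => // b Ob ba; rewrite distrC; exact: H.
Qed.

Lemma taylor_barxx f a : taylor_bar f a a = glim f a.
Proof.
by rewrite /taylor_bar subrr big1 ?addr0 // => i _; rewrite mxE mulr0.
Qed.

Lemma taylor_barB f a x : taylor_bar f a x - glim f a
  = \sum_i glim (partial f i) a * (x - a) ord0 i.
Proof. by rewrite /taylor_bar addrC addKr. Qed.

End ClosureLimits.

(** * Gluing the averages over all scales *)

Section Extension.
Context {R : realType} {d : nat}.
Notation V := 'rV[R]_d.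
Variables (Om : set V) (h : nat -> R) (cov : forall n, cover Om (h n)).
Hypotheses (h_gt0 : forall n, 0 < h n) (hS : forall n, h n.+1 = h n / 8).
Implicit Types (f g : V -> R) (x y a b : V).

Lemma h_small (e : R) : 0 < e -> exists n, h n < e.
Proof.
move=> e0; have H n : h n * n.+1%:R <= h 0%N.
  elim: n => [|n IH]; first by rewrite mulr1.
  have hn0 := h_gt0 n.
  have hn : 0 <= h n * n%:R by rewrite mulr_ge0 // ltW.
  move: IH; rewrite hS -(natr1 n.+1) -(natr1 n) mulrDr mulr1 => IH.
  have -> : h n / 8 * (n%:R + 1 + 1) = (h n * n%:R + 2 * h n) / 8 by ring.
  lra.
exists (Num.truncn (h 0%N / e)).
have := truncnS_gt (h 0%N / e); rewrite ltr_pdivrMr // => lt.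
rewrite -(ltr_pM2r (ltr0Sn R (Num.truncn (h 0%N / e)))) (mulrC e).
exact: le_lt_trans (H _) lt.
Qed.

Lemma h_antitone m n : (m <= n)%N -> h n <= h m.
Proof.
move=> mn; rewrite -(subnKC mn); elim: (n - m)%N => [|k IH]; first by rewrite addn0.
rewrite addnS hS; have := h_gt0 (m + k); lra.
Qed.

Definition far x (e : R) := forall y, Om y -> e <= `|x - y|.

Lemma far_exists x : ~ closure Om x -> exists n, far x (h n).
Proof.
move=> ncx; apply/not_existsP => H; apply/ncx/closure_normP => e e0.
have [n ne] := h_small e e0.
have /existsNP[y /not_implyP[Oy /negP]] := H n.
by rewrite -ltNge distrC => yx; exists y => //; exact: lt_trans ne.
Qed.

Lemma far_near x (e u : R) z : far x (e + u) -> `|z - x| <= u -> far z e.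
Proof.
move=> fx zx y Oy; have := fx y Oy; have := ler_distD z x y.
rewrite (distrC x z); lra.
Qed.

Lemma far_closure x a (e : R) : far x e -> closure Om a -> e <= `|x - a|.
Proof.
move=> fx ca; apply/ler_addgt0Pr => u u0.
have [y Oy ya] := (closure_normP _ a).1 ca u u0.
have := fx y Oy; have := ler_distD a x y; rewrite (distrC a y); lra.
Qed.

(** Selects the scale comparable to the distance from [x] to [Om], by going up to coarser scales
    until [x] is no longer far. *)
Lemma far_levelP x n : far x (h n) ->
  far x (h 0%N) \/ exists k, far x (h k.+1) /\ exists2 y, Om y & `|x - y| < h k.
Proof.
elim: n => [|n IH] fx; first by left.
have [/IH//|/existsNP[y /not_implyP[Oy /negP]]] := pselect (far x (h n)).
by rewrite -ltNge => xy; right; exists n; split=> //; exists y.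
Qed.

(* The finer average overrides the coarser ones near [Om]; where [mass (cov k)] is
   [1] the levels below [k] are forgotten. *)
Fixpoint approx f n : V -> R := match n with
  | 0%N => patch (cov 0%N) f
  | m.+1 => patch (cov m.+1) f \+ (cst 1 \- mass (cov m.+1)) \* approx f m
  end.

Lemma approx_C1 f n : C1 (approx f n).
Proof.
elim: n => [|n IH] /=; first exact: patch_C1.
apply: C1D; first exact: patch_C1.
apply: C1M => //.
have -> : cst 1 \- mass (cov n.+1) = cst 1 \+ (cst (-1) \* mass (cov n.+1)).
  by apply/funext => x /=; rewrite mulN1r.
apply: C1D; first exact: C1_cst.
by apply: C1M; [exact: C1_cst|exact: mass_C1].
Qed.

Lemma approx_stable f n m x : far x (h n / 2) -> (n <= m)%N ->
  approx f m x = approx f n x.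
Proof.
move=> fx nm; rewrite -(subnKC nm); elim: (m - n)%N => [|k IH].
  by rewrite addn0.
rewrite addnS /= IH.
have [|-> ->] := patch_mass_far _ _ (cov (n + k).+1) f x.
  move=> y Oy; apply: lt_le_trans (fx y Oy).
  (* The ratio 8 matters here: finer weights reach no farther than [3 * h n / 8], which is below
     [h n / 2]. *)
  rewrite hS; have := h_gt0 n; have := @h_antitone n (n + k) (leq_addr _ _); lra.
by rewrite add0r subr0 mul1r.
Qed.

(* Outside the closure of [Om] the sequence [approx f n x] is eventually constant
   and any [n] with [far x (h n)] gives its limit; the default [0%N] is never used. *)
Definition ext f x : R := if `[< closure Om x >] then glim Om f x
  else approx f (xget 0%N [set n | far x (h n)]) x.

Lemma ext_closure f x : closure Om x -> ext f x = glim Om f x.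
Proof. by move=> cx; rewrite /ext asboolT. Qed.

Lemma far_not_closure x n : far x (h n) -> ~ closure Om x.
Proof.
move=> fx cx; have := far_closure x x (h n) fx cx.
by rewrite subrr normr0 leNgt h_gt0.
Qed.

Lemma far_half x n : far x (h n) -> far x (h n / 2).
Proof. move=> fx y /fx; have := h_gt0 n; lra. Qed.

Lemma ext_far f x n : far x (h n) -> ext f x = approx f n x.
Proof.
move=> fx; rewrite /ext asboolF; last exact: far_not_closure fx.
case: xgetP => [m _ /= fm|/(_ n)//].
have [mn|nm] := leqP m n.
  by rewrite (approx_stable f m n) //; exact: far_half.
by rewrite (approx_stable f n m) ?(ltnW nm) //; exact: far_half.
Qed.

Lemma ext_near f x n : far x (h n) -> \forall z \near x, ext f z = approx f n z.
Proof.
move=> fx; apply/nearP; exists (h n / 2); first by rewrite divr_gt0.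
move=> z zx.
have fz : far z (h n / 2).
  apply: (far_near x _ (h n / 2) z); last exact: ltW.
  by rewrite -splitr.
(* Moving from [x] to [z] costs half of the distance, so the value is read at level [n.+1] and
   brought back to [n] by stability. *)
rewrite (ext_far f z n.+1).
  by rewrite (approx_stable f n n.+1).
by move=> y /fz; rewrite hS; have := h_gt0 n; lra.
Qed.

Lemma ext_C1_far f x n : far x (h n) ->
  [/\ differentiable (ext f) x,
      forall i, partial (ext f) i x = partial (approx f n) i x &
      forall i, {for x, continuous (partial (ext f) i)}].
Proof.
move=> fx; have near_x := ext_near f x n fx.
have [dA cA] := approx_C1 f n.
have pE z : (\forall t \near z, ext f t = approx f n t) ->
    forall i, partial (ext f) i z = partial (approx f n) i z.
  by move=> H i; apply: near_eq_derive.
have [dE _] : differentiable (ext f) x /\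
    forall i, partial (ext f) i x = partial (approx f n) i x.
  apply: near_eq_differentiable (dA x).
  by apply: filterS near_x => z ->.
split=> // [i|i]; first exact: pE.
apply/continuous_atP => e e0.
have /continuous_atP /(_ e e0) := cA i x.
(* Equality near each [z] close to [x] is required to compare partial derivatives at [z]. *)
have /nbhs_interior near_near : nbhs x [set z | ext f z = approx f n z] by [].
by apply: filterS2 near_near => z zE; rewrite !pE.
Qed.

(** The level chosen by [ext] depends on [x] only, so linearity can be checked on each level. *)
Lemma extDl (c : R) f g : C1_closure Om f -> C1_closure Om g ->
  ext (fun x => c * f x + g x) = (fun x => c * ext f x + ext g x).
Proof.
move=> [df [uf _]] [dg [ug _]]; apply/funext => x; rewrite /ext.
case: asboolP => cx; first exact: glimDl.
elim: (xget _ _) => [|n IH] /=; first exact: patchDl.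
rewrite IH patchDl //; ring.
Qed.

Lemma ext_id f x : open Om -> C1_closure Om f -> Om x -> ext f x = f x.
Proof.
move=> oOm [df _] Ox; have cx : closure Om x by exact: subset_closure.
rewrite ext_closure //; apply: cvg_glim => //.
apply: cvg_within_filter.
exact: (differentiable_continuous (df x Ox)).
Qed.

End Extension.

(** * Estimates for the extension *)

Section Whitney.
Context {R : realType} {d : nat}.
Notation V := 'rV[R]_d.
Variables (Om : set V) (h : nat -> R) (cov : forall n, cover Om (h n)) (r L : R).
Hypotheses (h_gt0 : forall n, 0 < h n) (hS : forall n, h n.+1 = h n / 8).
Hypotheses (hr : 4 * h 0%N <= r) (L1 : 1 <= L) (qcOm : quasiconvex_max Om r L).
Variable f : V -> R.
Hypothesis Cf : C1_closure Om f.
Local Notation E := (ext Om h cov f).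
Local Notation D := (d%:R * L).

Let L0 : 0 <= L. Proof. exact: le_trans L1. Qed.
Let D0 : 0 <= D. Proof. exact: mulr_ge0. Qed.
Let df x : Om x -> differentiable f x. Proof. by case: Cf => + _; apply. Qed.
Let uf : unif_cont_on Om f. Proof. by case: Cf => _ []. Qed.
Let up i : unif_cont_on Om (partial f i). Proof. by case: Cf => _ []. Qed.

(** Near such an [x] the extension is the two-scale function of levels [k] and [k.+1], to which
    [two_scale_deviation] applies with [l = taylor f b]. *)
Lemma ext_deviation x b k (eta : R) : Om b -> `|x - b| < h k -> far Om x (h k.+1) ->
  0 <= eta -> grad_osc Om f b (4 * L * h k) eta ->
  `|E x - taylor f b x| <= 14 * D * eta * h k /\
  forall i, `|partial E i x - partial f i b| <= (12 * 8 * 7 * D + 2) * eta.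
Proof.
move=> Ob xb fx eta0 osc.
have hk := h_gt0 k.
have hk0 : h k <= h 0%N by exact: h_antitone.
pose G := patch (cov k.+1) f \+ (cst 1 \- mass (cov k.+1)) \* patch (cov k) f.
have EG : \forall z \near x, E z = G z.
  (* At level 0 this is the definition; at later levels [mass (cov k)] is 1 near [x] and erases the
     coarser ones. *)
  have m1 : \forall z \near x, approx Om h cov f k z = patch (cov k) f z.
    case: k xb {fx osc hk hk0 G} => [|k] xb; first by apply/nearP; exists 1.
    have := mass_eq1_near (cov k.+1) x b Ob xb.
    by apply: filterS => z /= ->; rewrite subrr mul0r addr0.
  apply: filterS2 m1 (ext_near Om h cov h_gt0 hS f x k.+1 fx) => z /= m1 ->.
  by rewrite /G /= m1.
(* The 7 is 4 + 3: a relevant node [p] is within [4 * h k] of [b] and [3 * h k] of [x]. *)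
have dG := two_scale_deviation Om (h k) (h k.+1) (cov k) (cov k.+1) f
  (taylor f b) x b (7 * D * eta * h k) eta.
have A0 : 0 <= 7 * D * eta * h k by rewrite !mulr_ge0 // ltW.
have hk' : h k.+1 <= h k by exact: h_antitone.
have dT z : differentiable (taylor f b) z by case: (taylor_differentiable f b z).
have [p Op xp|D1 D2] := dG hk (h_gt0 _) hk' Ob xb dT A0 eta0.
  have pb : `|p - b| <= 4 * h k.
    by have := ler_distD x p b; rewrite (distrC p x); lra.
  have pbL : L * `|p - b| <= 4 * L * h k.
    by rewrite -mulrA mulrCA ler_wpM2l.
  have oscp : grad_osc Om f b (L * `|p - b|) eta.
    by move=> z Oz zb i; apply: osc => //; exact: le_trans pbL.
  split=> [|i]; last first.
    have [_ ->] := taylor_differentiable f b x.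
    apply: osc => //; apply: le_trans pbL; exact: ler_peMl.
  have pbr : `|p - b| <= r.
    by apply: le_trans pb (le_trans _ hr); rewrite ler_wpM2l.
  apply: le_trans (taylor_diff Om r L f L1 qcOm df b p x eta Ob Op pbr eta0 oscp) _.
  have -> : 7 * D * eta * h k = d%:R * eta * L * (7 * h k) by ring.
  by rewrite ler_wpM2l ?mulr_ge0 //; lra.
split=> [|i].
  rewrite (nbhs_singleton EG) (le_trans D1) //.
  by have -> : 2 * (7 * D * eta * h k) = 14 * D * eta * h k by ring.
have -> : partial E i x = partial G i x by exact: near_eq_derive.
have := D2 i.
have [_ ->] := taylor_differentiable f b x.
move=> /le_trans; apply; rewrite [h k.+1]hS.
have -> : 12 / (h k / 8) * (7 * D * eta * h k) + 2 * eta = (12 * 8 * 7 * D + 2) * eta.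
  by field; rewrite gt_eqF.
exact: lexx.
Qed.

Lemma grad_osc_small (eta : R) : 0 < eta -> exists2 rho : R, 0 < rho &
  forall b u, Om b -> u < rho -> grad_osc Om f b u eta.
Proof.
move=> eta0.
have [|rho_ H] := @choice 'I_d R (fun i q => 0 < q /\
    forall x y, Om x -> Om y -> `|x - y| < q ->
      `|partial f i x - partial f i y| < eta).
  move=> i; have [q q0 Hq] := unif_cont_on_norm Om _ (up i) eta eta0.
  by exists q.
(* The initial value 1 keeps the minimum positive in dimension 0. *)
exists (\big[Num.min/1]_i rho_ i).
  by apply: lt_bigmin => // i _; case: (H i).
move=> b u Ob u_rho z Oz zb i; apply/ltW; apply: (H i).2 => //.
apply: le_lt_trans zb (lt_le_trans u_rho _); exact: bigmin_le.
Qed.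

(* Every [x] close to [a] in the closure sees a Taylor polynomial at a point of
   [Om] whose distance to [x] is comparable to [`|x - a|]; off the closure of [Om]
   this is [ext_deviation], on the closure it is a limit. *)
Lemma ext_taylor_approx a x (eta rho : R) : closure Om a -> x != a -> 0 < eta ->
  (forall b u, Om b -> u < rho -> grad_osc Om f b u eta) ->
  `|x - a| < h 0%N -> 32 * L * `|x - a| < rho ->
  exists2 b, Om b /\ `|x - b| <= 8 * `|x - a| &
    `|E x - taylor f b x| <= (14 * 8 * D + 1) * eta * `|x - a|.
Proof.
move=> ca xa eta0 osc xah xarho.
have u0 : 0 < `|x - a| by rewrite normr_gt0 subr_eq0.
have [cx|ncx] := pselect (closure Om x).
  have eu0 : 0 < eta * `|x - a| by exact: mulr_gt0.
  have [q q0 Hq] := taylor_cvg Om f x x _ Cf cx eu0.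
  have mq0 : 0 < Num.min q `|x - a| by rewrite lt_min q0.
  have [b Ob] := (closure_normP Om x).1 cx _ mq0.
  rewrite lt_min => /andP[bq bu]; exists b.
    by split=> //; rewrite distrC; lra.
  have := Hq b Ob bq; rewrite taylor_barxx ext_closure // distrC => /ltW /le_trans.
  by apply; rewrite mulrDl mul1r mulrDl lerDr !mulr_ge0 // ltW.
have [n fn] := far_exists Om h h_gt0 hS x ncx.
have [f0|[k [fk [b Ob xb]]]] := far_levelP Om h x n fn.
  by have := far_closure Om x a _ f0 ca; rewrite leNgt xah.
(* Being far from [Om] at scale [h k.+1 = h k / 8] also bounds the distance to [a] from below. *)
have hk8 : h k <= 8 * `|x - a|.
  by have := far_closure Om x a _ fk ca; rewrite hS; lra.
exists b; first by split=> //; apply/ltW/(lt_le_trans xb).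
have [|H _] := ext_deviation x b k eta Ob xb fk (ltW eta0).
  apply: osc => //; apply: le_lt_trans xarho.
  have -> : 32 * L * `|x - a| = 4 * L * (8 * `|x - a|) by ring.
  by rewrite ler_wpM2l // mulr_ge0.
apply: le_trans H _.
apply: (@le_trans _ _ (14 * D * eta * (8 * `|x - a|))).
  by rewrite ler_wpM2l // !mulr_ge0 // ltW.
have -> : 14 * D * eta * (8 * `|x - a|) = 14 * 8 * D * eta * `|x - a| by ring.
by rewrite ler_wpM2r // ler_wpM2r ?lerDl // ltW.
Qed.

(** [E x] is compared with [taylor f b x], then with [taylor f a' x] for a point [a'] of [Om] near
    [a], then with [taylor_bar Om f a x], each time up to a small multiple of [|x - a|]. *)
Lemma ext_closure_differentiable a : closure Om a ->
  differentiable E a /\ forall i, partial E i a = glim Om (partial f i) a.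
Proof.
move=> ca; apply: expand_differentiable => e e0.
(* The three errors add up: 130 is 14 * 8 + 18, and 2 is 1 + 1. *)
have C0 : 0 < 130 * D + 2 by have := D0; lra.
have [eta eta0 etaE] : exists2 eta : R, 0 < eta & (130 * D + 2) * eta = e.
  exists (e / (130 * D + 2)); first exact: divr_gt0.
  by rewrite mulrC divfK // gt_eqF.
have [rho rho0 osc] := grad_osc_small eta eta0.
have Lp : 0 < L by apply: lt_le_trans L1.
have h00 := h_gt0 0%N.
apply/nearP; exists (Num.min (h 0%N / 10) (rho / (32 * L))).
  by rewrite lt_min !divr_gt0 // mulr_gt0.
move=> x; rewrite lt_min !ltr_pdivlMr ?mulr_gt0 // => /andP[xh].
rewrite mulrC => xrho.
have [->|xa] := eqVneq x a.
  by rewrite !subrr normr0 mulr0 big1 ?subr0 ?normr0 // => i _; rewrite mxE mulr0.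
have u0 : 0 < `|x - a| by rewrite normr_gt0 subr_eq0.
have xh0 : `|x - a| < h 0%N by lra.
have [b [Ob xb] Exb] := ext_taylor_approx a x eta rho ca xa eta0 osc xh0 xrho.
have eu0 : 0 < eta * `|x - a| by exact: mulr_gt0.
have [q q0 Hq] := taylor_cvg Om f a x _ Cf ca eu0.
have mq0 : 0 < Num.min q `|x - a| by rewrite lt_min q0.
have [a' Oa'] := (closure_normP Om a).1 ca _ mq0.
rewrite lt_min => /andP[aq au].
have a'x := Hq a' Oa' aq.
have ba' : `|b - a'| <= 10 * `|x - a|.
  have := ler_distD x b a'; have := ler_distD a x a'.
  by rewrite (distrC b x) (distrC a a'); lra.
(* The 18 is 10 for [|b - a'|] plus 8 for [|x - b|]. *)
have T : `|taylor f b x - taylor f a' x| <= 18 * D * eta * `|x - a|.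
  have ba'r : `|b - a'| <= r.
    by apply: le_trans ba' (le_trans _ hr); lra.
  have osc' : grad_osc Om f a' (L * `|b - a'|) eta.
    apply: osc => //; apply: le_lt_trans xrho.
    have -> : 32 * L * `|x - a| = L * (32 * `|x - a|) by ring.
    by rewrite ler_wpM2l //; lra.
  have := taylor_diff Om r L f L1 qcOm df a' b x eta Oa' Ob ba'r (ltW eta0) osc'.
  move=> /le_trans; apply.
  have -> : 18 * D * eta * `|x - a| = d%:R * eta * L * (18 * `|x - a|) by ring.
  have c0 : 0 <= d%:R * eta * L by rewrite !mulr_ge0 // ltW.
  by rewrite ler_wpM2l //; lra.
rewrite (ext_closure Om h cov f a ca) -addrA -opprD -taylor_barB [glim _ _ _ + _]addrC subrK.
have -> : e * `|x - a| = (14 * 8 * D + 1) * eta * `|x - a|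
    + 18 * D * eta * `|x - a| + eta * `|x - a|.
  by rewrite -etaE; ring.
have := ler_distD (taylor f b x) (E x) (taylor_bar Om f a x).
have := ler_distD (taylor f a' x) (taylor f b x) (taylor_bar Om f a x).
lra.
Qed.

(** At closure points the partial derivative is a limit of values on [Om]; off the closure,
    [ext_deviation] compares it with the value at a nearby [b] in [Om]. *)
Lemma ext_partial_continuous_closure a i : closure Om a ->
  {for a, continuous (partial E i)}.
Proof.
move=> ca; apply/continuous_atP => e e0.
have [_ pa] := ext_closure_differentiable a ca; rewrite pa.
have e20 : 0 < e / 2 by exact: divr_gt0.
have [q q0 Hq] := glimP Om (partial f i) a _ (up i) ca e20.
have C0 : 0 < 12 * 8 * 7 * D + 2 by have := D0; lra.
have [eta eta0 etaE] : exists2 eta : R, 0 < eta & (12 * 8 * 7 * D + 2) * eta = e / 2.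
  exists (e / 2 / (12 * 8 * 7 * D + 2)); first exact: divr_gt0.
  by rewrite mulrC divfK // gt_eqF.
have [rho rho0 osc] := grad_osc_small eta eta0.
have Lp : 0 < L by apply: lt_le_trans L1.
have h00 := h_gt0 0%N.
(* The point [b] is within [8 * |x - a|] of [x], hence within [9 * |x - a|] of [a]. *)
apply/nearP; exists (Num.min (Num.min (h 0%N) (q / 9)) (rho / (32 * L))).
  by rewrite !lt_min h00 !divr_gt0 // mulr_gt0.
move=> x; rewrite !lt_min !ltr_pdivlMr ?mulr_gt0 // => /andP[/andP[xh xq]].
rewrite mulrC => xrho.
have [cx|ncx] := pselect (closure Om x).
  have [_ ->] := ext_closure_differentiable x cx.
  have [s s0 Hs] := glimP Om (partial f i) x _ (up i) cx e20.
  have ms0 : 0 < Num.min s (q / 2) by rewrite lt_min s0 divr_gt0.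
  have [y Oy] := (closure_normP Om x).1 cx _ ms0.
  rewrite lt_min => /andP[ys yq].
  have H : `|partial f i y - glim Om (partial f i) a| < e / 2.
    by apply: Hq => //; apply: le_lt_trans (ler_distD x y a) _; lra.
  apply: le_lt_trans (ler_distD (partial f i y) _ _) _.
  by rewrite (splitr e) distrC; apply: ltrD; first exact: Hs.
have [n fn] := far_exists Om h h_gt0 hS x ncx.
have [f0|[k [fk [b Ob xb]]]] := far_levelP Om h x n fn.
  by have := far_closure Om x a _ f0 ca; rewrite leNgt xh.
have hk8 : h k <= 8 * `|x - a|.
  by have := far_closure Om x a _ fk ca; rewrite hS; lra.
have [|_ /(_ i) H] := ext_deviation x b k eta Ob xb fk (ltW eta0).
  apply: osc => //; apply: le_lt_trans xrho.
  have -> : 32 * L * `|x - a| = 4 * L * (8 * `|x - a|) by ring.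
  by rewrite ler_wpM2l // mulr_ge0.
rewrite etaE in H.
have ba : `|b - a| < q.
  by have := ler_distD x b a; rewrite (distrC b x); lra.
have := Hq b Ob ba.
have := ler_distD (partial f i b) (partial E i x) (glim Om (partial f i) a).
lra.
Qed.

Lemma ext_differentiable x : differentiable E x.
Proof.
have [cx|ncx] := pselect (closure Om x).
  by case: (ext_closure_differentiable x cx).
have [n fn] := far_exists Om h h_gt0 hS x ncx.
by case: (ext_C1_far Om h cov h_gt0 hS f x n fn).
Qed.

Lemma ext_partial_continuous i : continuous (partial E i).
Proof.
move=> x; have [cx|ncx] := pselect (closure Om x).
  exact: ext_partial_continuous_closure.
have [n fn] := far_exists Om h h_gt0 hS x ncx.
by case: (ext_C1_far Om h cov h_gt0 hS f x n fn) => _ _; apply.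
Qed.

(** A sum dominating the constants of all cases of [ext_bounded]; it depends on [d], [L] and [h 0]
    but not on [f]. *)
Definition ext_bound : R := 5 + 4 * (d%:R * h 0%N)
  + 4 / h 0%N * (1 + 3 * (d%:R * h 0%N)) + 28 * (D * h 0%N) + 2 * (12 * 8 * 7 * D).

Lemma ext_bound_ge0 : 0 <= ext_bound.
Proof.
have h00 := ltW (h_gt0 0%N); rewrite /ext_bound.
by rewrite !addr_ge0 // !mulr_ge0 ?invr_ge0 // addr_ge0 // !mulr_ge0.
Qed.

Lemma ext_bounded (M : R) : Om !=set0 -> C1_bounded_by Om f M ->
  C1_bounded_by setT E (ext_bound * M).
Proof.
move=> [y0 Oy0] bM x _.
have M0 : 0 <= M by apply: le_trans (bM y0 Oy0).1.
have h00 := h_gt0 0%N.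
have P0 : 0 <= d%:R * h 0%N by rewrite mulr_ge0 // ltW.
have DH0 : 0 <= D * h 0%N by rewrite mulr_ge0 // ltW.
have Q0 : 0 <= 4 / h 0%N * (1 + 3 * (d%:R * h 0%N)).
  by rewrite mulr_ge0 ?divr_ge0 ?(ltW h00) // addr_ge0 // mulr_ge0.
have D0' := D0.
have leC (u : R) : u <= ext_bound -> u * M <= ext_bound * M.
  by move=> ?; rewrite ler_wpM2r.
have [cx|ncx] := pselect (closure Om x).
  have MC : M <= ext_bound * M.
    by rewrite -[leLHS]mul1r; apply: leC; rewrite /ext_bound; lra.
  split=> [|i].
    rewrite ext_closure //; apply: le_trans MC.
    by apply: glim_le => // y Oy; case: (bM y Oy).
  have [_ ->] := ext_closure_differentiable x cx; apply: le_trans MC.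
  by apply: glim_le => // y Oy; case: (bM y Oy) => _; apply.
have tayM p (u : R) : Om p -> `|x - p| <= u -> `|taylor f p x| <= M + d%:R * M * u.
  move=> Op xp; apply: le_trans (ler_normD _ _) _; apply: lerD.
    by case: (bM p Op).
  apply: le_trans (sum_coord_le _ _ M _) _; last by rewrite ler_wpM2l // mulr_ge0.
  by case: (bM p Op).
have [n fn] := far_exists Om h h_gt0 hS x ncx.
have [f0|[k [fk [b Ob xb]]]] := far_levelP Om h x n fn.
  have [_ pE _] := ext_C1_far Om h cov h_gt0 hS f x 0%N f0.
  (* Far from [Om] only the coarsest patch is left, and it is compared with the zero function. *)
  have [||||D1 D2] := patch_deviation Om (h 0%N) (cov 0%N) f (cst 0) x
    (M + d%:R * M * (3 * h 0%N)) M.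
  - by move=> y; exact: differentiable_cst.
  - by rewrite addr_ge0 // !mulr_ge0 // ltW.
  - by [].
  - move=> q xq; rewrite /= subr0; split; first by apply: tayM => //; exact: node_in.
    by move=> i; rewrite partial_cst subr0; case: (bM _ (node_in (cov 0%N) q)).
  split=> [|i].
    rewrite (ext_far Om h cov h_gt0 hS f x 0%N f0) /=.
    move: D1; rewrite /= mulr0 subr0 => /le_trans; apply.
    have -> : M + d%:R * M * (3 * h 0%N) = (1 + 3 * (d%:R * h 0%N)) * M by ring.
    by apply: leC; rewrite /ext_bound; lra.
  rewrite pE /=; have := D2 i.
  rewrite partialM; [|by case: (mass_C1 (cov 0%N))|exact: differentiable_cst].
  rewrite partial_cst /= mulr0 mul0r addr0 subr0 => /le_trans; apply.
  have -> : 4 / h 0%N * (M + d%:R * M * (3 * h 0%N)) + M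
    = (4 / h 0%N * (1 + 3 * (d%:R * h 0%N)) + 1) * M by ring.
  by apply: leC; rewrite /ext_bound; lra.
have hk0 : h k <= h 0%N by exact: h_antitone.
(* The gradient is bounded by [M], so its oscillation is at most [2 * M] at every distance. *)
have [||D1 D2] := ext_deviation x b k (2 * M) Ob xb fk.
- by rewrite mulr_ge0.
- move=> z Oz _ i; apply: le_trans (ler_normB _ _) _.
  have [_ /(_ i)] := bM z Oz; have [_ /(_ i)] := bM b Ob; lra.
split=> [|i].
  have := tayM b (h 0%N) Ob (le_trans (ltW xb) hk0).
  have {}D1 : `|E x - taylor f b x| <= 28 * (D * h 0%N) * M.
    apply: le_trans D1 _.
    have -> : 14 * D * (2 * M) * h k = 28 * D * M * h k by ring.
    have -> : 28 * (D * h 0%N) * M = 28 * D * M * h 0%N by ring.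
    by rewrite ler_wpM2l // !mulr_ge0.
  have := ler_normD (E x - taylor f b x) (taylor f b x); rewrite subrK => H1 H2.
  apply: (@le_trans _ _ ((28 * (D * h 0%N) + (1 + d%:R * h 0%N)) * M)).
    by rewrite mulrDl mulrDl mul1r mulrAC; lra.
  by apply: leC; rewrite /ext_bound; lra.
have := ler_normD (partial E i x - partial f i b) (partial f i b).
rewrite subrK => H1; have := D2 i; have [_ /(_ i) H2] := bM b Ob => H3.
apply: (@le_trans _ _ ((2 * (12 * 8 * 7 * D) + 5) * M)); last first.
  by apply: leC; rewrite /ext_bound; lra.
have : (12 * 8 * 7 * D + 2) * (2 * M) = (2 * (12 * 8 * 7 * D) + 4) * M by ring.
have : (2 * (12 * 8 * 7 * D) + 5) * M = (2 * (12 * 8 * 7 * D) + 4) * M + M by ring.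
lra.
Qed.

End Whitney.

(* The nodes of a fine cover form a finite net of [Om]. *)
Lemma unif_cont_on_bounded (R : realType) (d : nat) (Om : set 'rV[R]_d)
    (g : 'rV[R]_d -> R) : bounded_set Om -> Om !=set0 -> unif_cont_on Om g ->
  exists2 M : R, 0 <= M & forall y, Om y -> `|g y| <= M.
Proof.
move=> bOm Om0 ug; have [r r0 H] := unif_cont_on_norm Om g ug 1 ltr01.
have r40 : 0 < r / 4 by exact: divr_gt0.
have [c _] := cover_exists Om (r / 4) r40 bOm Om0.
have S0 : 0 <= \sum_q `|g (node c q)| by exact: sumr_ge0.
exists (1 + \sum_q `|g (node c q)|) => [|y Oy]; first exact: addr_ge0.
(* Otherwise all weights vanish at [y], although they sum to 1 there. *)
have [q yq] : exists q, `|y - node c q| <= 3 * (r / 4).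
  apply/not_existsP => far; have := oner_neq0 R; apply/negP/negPn/eqP.
  rewrite -(sum_weight_eq1 c y y Oy) ?subrr ?normr0 //.
  apply: big1 => q _; apply: weight_supp; rewrite ltNge; exact/negP/far.
have gq : `|g (node c q)| <= \sum_q `|g (node c q)|.
  by rewrite (bigD1 q) //= lerDl sumr_ge0.
have : `|g y - g (node c q)| < 1.
  by apply: H => //; [exact: node_in|lra].
have := ler_normD (g y - g (node c q)) (g (node c q)); rewrite subrK; lra.
Qed.

Lemma C1_closure_bounded (R : realType) (d : nat) (Om : set 'rV[R]_d)
    (f : 'rV[R]_d -> R) : bounded_set Om -> Om !=set0 -> C1_closure Om f ->
  exists M : R, C1_bounded_by Om f M.
Proof.
move=> bOm Om0 [_ [uf up]].
have [M M0 fM] := unif_cont_on_bounded R d Om f bOm Om0 uf.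
have [|N HN] := @choice 'I_d R (fun i q => 0 <= q /\
    forall y, Om y -> `|partial f i y| <= q).
  move=> i; have [q q0 Hq] := unif_cont_on_bounded R d Om _ bOm Om0 (up i).
  by exists q.
have N0 i : 0 <= N i by case: (HN i).
exists (M + \sum_i N i) => y Oy; split=> [|i].
  by apply: le_trans (fM y Oy) _; rewrite lerDl sumr_ge0.
apply: le_trans ((HN i).2 y Oy) _; rewrite (bigD1 i) //= addrCA lerDl.
by rewrite addr_ge0 // sumr_ge0.
Qed.

Theorem theorem2p7 (R : realType) (d : nat) (Om : set 'rV[R]_d) :
  open Om -> bounded_set Om -> unif_loc_quasiconvex Om ->
  exists E : ('rV[R]_d -> R) -> ('rV[R]_d -> R),
    [/\ (* linearity on C^1(\bar Om) *)
        (forall (a : R) f g, C1_closure Om f -> C1_closure Om g ->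
           E (fun x => a * f x + g x) = (fun x => a * E f x + E g x)),
        (* E maps C^1(\bar Om) into C^1_b(R^d) *)
        (forall f, C1_closure Om f -> C1b (E f)),
        (* boundedness: ||E f||_{C^1_b} <= C ||f||_{C^1(\bar Om)} *)
        (exists C : R, 0 <= C /\ forall f M, C1_closure Om f ->
           C1_bounded_by Om f M -> C1_bounded_by setT (E f) (C * M)) &
        (* extension: E f = f on Om, and on \bar Om E f and its gradient
           coincide with the continuous extensions of f and grad f *)
        (forall f, C1_closure Om f ->
           (forall x, Om x -> E f x = f x) /\
           (forall x, closure Om x ->
              f @ within Om (nbhs x) --> E f x /\
              forall i, partial f i @ within Om (nbhs x) --> partial (E f) i x))].
Proof.
move=> oOm bOm /unif_loc_quasiconvex_max [r [L [r0 L1 qcOm]]].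
(* A cover takes its nodes in [Om]; for empty [Om] the zero operator serves. *)
have [[y0 Oy0]|/set0P/negP/negPn/eqP Om0] := pselect (Om !=set0); last first.
  exists (fun _ => cst 0); split.
  - by move=> a f g _ _; apply/funext => x /=; rewrite mulr0 addr0.
  - move=> f _; have [dc cc] := @C1_cst R d 0; split=> //; split=> //.
    by exists 0 => x _; split=> [|i]; rewrite ?partial_cst normr0.
  - exists 0; split=> // f M _ _ x _.
    by split=> [|i]; rewrite ?partial_cst mul0r normr0.
  - by move=> f _; split=> x; rewrite Om0 ?closure0.
(* Starting at [r / 4] keeps points of [Om] within [4 * h 0] of each other in the range of
   quasiconvexity. *)
pose h (n : nat) : R := r / 4 / 8 ^+ n.
have h_gt0 n : 0 < h n by rewrite !divr_gt0 // exprn_gt0.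
have hS n : h n.+1 = h n / 8 by rewrite /h exprSr invfM mulrA.
have hr : 4 * h 0%N <= r by rewrite /h expr0 divr1 mulrC divfK.
have Om_neq0 : Om !=set0 by exists y0.
(* The covers are chosen once, before any [f], as linearity demands. *)
pose cov n : cover Om (h n) := sval (cid (cover_exists Om (h n) (h_gt0 n) bOm Om_neq0)).
exists (ext Om h cov); split.
- by move=> a f g Cf Cg; exact: extDl.
- move=> f Cf; split; [|split].
  + by move=> x; exact: (ext_differentiable Om h cov r L).
  + by move=> i; exact: (ext_partial_continuous Om h cov r L).
  + have [M fM] := C1_closure_bounded R d Om f bOm Om_neq0 Cf.
    exists (@ext_bound R d h L * M); exact: (ext_bounded Om h cov r L).
- exists (@ext_bound R d h L); split; first exact: ext_bound_ge0.
  by move=> f M Cf; exact: (ext_bounded Om h cov r L).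
- move=> f Cf; split=> [x Ox|x cx]; first exact: ext_id.
  have [_ [uf up]] := Cf.
  rewrite ext_closure //; split; first exact: glim_cvg.
  move=> i; have [_ ->] :=
    ext_closure_differentiable Om h cov r L h_gt0 hS hr L1 qcOm f Cf x cx.
  exact: glim_cvg.
Qed.
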